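(* Let $\phi:\mathbb{R}\to\mathbb{C}$ be a $C^\infty$ function such that: (i) $\operatorname{supp}\phi\subset[-1/4-\delta,1/4+\delta]$ for some $0<\delta\le 1/4$; (ii) $\sum_{k\in\mathbb{Z}}|\phi(\xi+k/2)|^2=1$ for all $\xi\in\mathbb{R}$; (iii) $\phi^{(m)}(0)=0$ for all $m\ge 1$. Define functions $f_j\in L^2(\mathbb{R})$, $j=0,1,2,\ldots$, by $$\widehat f_0(\xi)=\begin{cases}\phi(\xi-1/4) & \xi>1/4,\\ \phi(0) & |\xi|\le 1/4,\\ \phi(\xi+1/4) & \xi<-1/4,\end{cases}$$ $$\widehat f_j(\xi)=\overline{\phi(\xi-j/2-1/4)}^{(j)}+(-1)^j\,\overline{\phi(\xi+j/2+1/4)}^{(j)}\qquad\text{for } j\ge 1.$$ Then the shift invariant system $\{T_kf_j: k\in\mathbb{Z},\ j=0,1,\ldots\}$ is an orthonormal basis of $L^2(\mathbb{R})$.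
   Context: The Fourier transform is $\widehat f(\xi)=\int_{\mathbb{R}}f(x)e^{-2\pi ix\xi}dx$ and $T_kf(x)=f(x-k)$. For $z\in\mathbb{C}$ and an integer $j$, $\overline z^{(j)}$ denotes $\overline z$ (complex conjugate) if $j$ is odd, and $z$ if $j$ is even. In (iii), $\phi^{(m)}$ denotes the $m$-th derivative. *)

(* Defs.v *)
From HB Require Import structures.
From mathcomp Require Import all_boot all_order all_algebra.
From mathcomp Require Import all_classical all_reals all_analysis.
From mathcomp Require Import complex.

Set Implicit Arguments.
Unset Strict Implicit.
Unset Printing Implicit Defensive.

Import Order.TTheory GRing.Theory Num.Theory.
Import numFieldNormedType.Exports.

Local Open Scope classical_set_scope.
Local Open Scope ring_scope.
Local Open Scope complex_scope.

Section ComplexValuedFunctions.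
Variable R : realType.
Implicit Types (f g : R -> R[i]) (z : R[i]).

Local Notation mu := (@lebesgue_measure R).

Definition re_fun f : R -> R := fun x => complex.Re (f x).
Definition im_fun f : R -> R := fun x => complex.Im (f x).

(* The modulus as an element of R (the library norm on R[i] is R[i]-valued). *)
Definition cabs z : R := complex.Re `|z|.

(* R[i] is not a normed module over R in the library, so derivatives and
   integrals of complex-valued functions of a real variable are taken on the
   real and imaginary parts. *)
Definition cderive1n (m : nat) f : R -> R[i] :=
  fun x => derive1n m (re_fun f) x +i* derive1n m (im_fun f) x.

Definition csmooth f : Prop :=
  forall (m : nat) (x : R),
    derivable (derive1n m (re_fun f)) x 1 /\
    derivable (derive1n m (im_fun f)) x 1.

Definition csupport f : set R := closure [set x | f x != 0].

Definition cintegral f : R[i] :=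
  (\int[mu]_x re_fun f x) +i* (\int[mu]_x im_fun f x).

(* L^p(R; C), at the level of functions: equality in L^p is equality a.e. *)
Definition inLp (p : \bar R) f : Prop :=
  re_fun f \in Lfun mu p /\ im_fun f \in Lfun mu p.

Definition L2dist f g : \bar R :=
  Lnorm mu 2%:E (fun x => (cabs (f x - g x))%:E).

Definition L2inner f g : R[i] := cintegral (fun x => f x * (g x)^*).

Definition expi (t : R) : R[i] := cos t +i* sin t.

Definition fourier f : R -> R[i] :=
  fun xi => cintegral (fun x => f x * expi (- (2 * pi * x * xi))).

(* [F] is the Fourier transform of [f] in L^2: the extension by continuity of
   the integral transform [fourier] from the dense subspace of L^1 /\ L^2. *)
Definition is_L2fourier f (F : R -> R[i]) : Prop :=
  [/\ inLp 2%:E f, inLp 2%:E F &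
    exists g_ : nat -> R -> R[i],
      [/\ forall n, inLp 1%:E (g_ n) /\ inLp 2%:E (g_ n),
          L2dist (g_ n) f @[n --> \oo] --> 0%E &
          L2dist (fourier (g_ n)) F @[n --> \oo] --> 0%E]].

Definition translate (k : int) f : R -> R[i] := fun x => f (x - k%:~R).

(* An orthonormal family whose finite linear combinations are dense. *)
Definition is_L2_orthonormal_basis (I : eqType) (e : I -> R -> R[i]) : Prop :=
  [/\ forall i, inLp 2%:E (e i),
      forall i j, L2inner (e i) (e j) = (i == j)%:R &
      forall g, inLp 2%:E g -> forall eps : R, 0 < eps ->
        exists (s : seq I) (c : I -> R[i]),
          (L2dist g (fun x => (\sum_(i <- s) c i * e i x)%R) < eps%:E)%E].

Definition conj_par (j : nat) z : R[i] := if odd j then z^* else z.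

Definition wilson_hat (phi : R -> R[i]) (j : nat) : R -> R[i] :=
  fun xi =>
    if j is 0 then
      if 1 / 4 < xi then phi (xi - 1 / 4)
      else if xi < - (1 / 4) then phi (xi + 1 / 4)
      else phi 0
    else
      conj_par j (phi (xi - j%:R / 2 - 1 / 4))
      + (-1) ^+ j * conj_par j (phi (xi + j%:R / 2 + 1 / 4)).

End ComplexValuedFunctions.

(* Main.v *)
Require Import Defs.
From HB Require Import structures.
From mathcomp Require Import all_boot all_order all_algebra.
From mathcomp Require Import all_classical all_reals all_analysis.
From mathcomp Require Import measurable_realfun.
From mathcomp Require Import complex.
From mathcomp Require Import ring lra zify.

(* By Plancherel, it suffices to show that the functions
   e^(-2 i pi k xi) F_j(xi), with F_j = wilson_hat phi j, form an orthonormal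
   basis.  This is a statement about the matrices (F_j(xi + m))_{j, m} for xi in
   a unit interval: near each half-integer only two consecutive translates a, b
   of phi are nonzero and |a|^2 + |b|^2 = 1, so these matrices are block diagonal
   with unitary blocks [a, b; conj b, - conj a] of size 2 (and a block [phi 0] of
   size 1).  Orthonormality and the Parseval identity then reduce to Fourier
   series on the unit interval.

   Parseval for Fourier series is obtained from the density of trigonometric
   polynomials in L2, for indicators of arcs first; it also yields Plancherel for
   compactly supported functions by periodization, and then in general. *)

Set Implicit Arguments.
Unset Strict Implicit.
Unset Printing Implicit Defensive.

Import Order.TTheory GRing.Theory Num.Theory.
Import numFieldNormedType.Exports.

Local Open Scope classical_set_scope.
(* In this order of scopes [^*] is [Num.conj], as in [L2inner], not [conjc]. *)
Local Open Scope complex_scope.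
Local Open Scope ring_scope.

(** * Complex numbers *)

(** The sign and the conjugation in [wilson_hat] are what makes two paired rows orthogonal: they
    meet the same two columns, with entries (a, b) and (conj b, - conj a). Which rows are paired
    depends on xi. For -1/4 < xi <= 1/4 the pairs are (2n - 1, 2n) and row 0 is left alone, on its
    plateau [phi 0] of modulus 1; for 1/4 < xi < 3/4 the pairs are (2n, 2n + 1). On the unit
    interval (-1/4, 3/4) the pairing thus changes only once, at 1/4.

    Functions are truncated before they are expanded. A function of bounded support meets finitely
    many columns, hence finitely many rows, so completeness needs only finitely many Fourier series,
    each cut off up to a small error.

    Estimates bear on squared norms: |z + w|^2 <= (1 + t) |z|^2 + (1 + 1/t) |w|^2 stands in for the
    triangle and Cauchy-Schwarz inequalities. *)

Section Complex.
Variable R : realType.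
Implicit Types z w : R[i].

(* The squared modulus; [nm] below is likewise the square of the L2 norm. *)
Definition sqn z : R := complex.Re z ^+ 2 + complex.Im z ^+ 2.

Lemma sqn_ge0 z : 0 <= sqn z.
Proof. by rewrite addr_ge0 ?sqr_ge0. Qed.

Lemma sqn0 : sqn 0 = 0.
Proof. by rewrite /sqn /= expr0n addr0. Qed.

Lemma sqnM z w : sqn (z * w) = sqn z * sqn w.
Proof. by case: z w => [a b] [c d]; rewrite /sqn /=; ring. Qed.

Lemma sqnJ z : sqn z^* = sqn z.
Proof. by case: z => a b; rewrite /sqn /= sqrrN. Qed.

Lemma sqnN z : sqn (- z) = sqn z.
Proof. by case: z => a b; rewrite /sqn /= !sqrrN. Qed.

Lemma sqn_real (x : R) : sqn x%:C = x ^+ 2.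
Proof. by rewrite /sqn /= expr0n addr0. Qed.

Lemma cabs_sqn z : cabs z = Num.sqrt (sqn z).
Proof. by rewrite /cabs normc_def. Qed.

Lemma cabs_ge0 z : 0 <= cabs z.
Proof. by rewrite cabs_sqn sqrtr_ge0. Qed.

Lemma sqr_cabs z : cabs z ^+ 2 = sqn z.
Proof. by rewrite cabs_sqn sqr_sqrtr ?sqn_ge0. Qed.

Lemma sqn_conjM z : z * z^* = (sqn z)%:C.
Proof.
case: z => a b; apply/eqP; rewrite eq_complex /sqn /=.
by apply/andP; split; apply/eqP; ring.
Qed.

(** The difference of the two sides is |t z - w|^2 / t. A small [t] gives continuity of the norm;
    [t = 1] gives the rougher bounds with factor 2. *)
Lemma sqnD_le (t : R) z w : 0 < t ->
  sqn (z + w) <= (1 + t) * sqn z + (1 + t^-1) * sqn w.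
Proof.
move=> t0; case: z w => [a b] [c d]; rewrite /sqn /= -subr_ge0.
have -> : (1 + t) * (a ^+ 2 + b ^+ 2) + (1 + t^-1) * (c ^+ 2 + d ^+ 2) -
    ((a + c) ^+ 2 + (b + d) ^+ 2) =
    t^-1 * ((t * a - c) ^+ 2 + (t * b - d) ^+ 2).
  by field; rewrite gt_eqF.
by apply: mulr_ge0; [rewrite invr_ge0 ltW|rewrite addr_ge0 ?sqr_ge0].
Qed.

Lemma sqnD2_le z w : sqn (z + w) <= 2 * sqn z + 2 * sqn w.
Proof. by have := @sqnD_le 1 z w ltr01; rewrite invr1. Qed.

(** From |z - w|^2 >= 0 and |z + w|^2 >= 0, up to a harmless factor 2: the bound serves only to make
    products of two L2 functions integrable. *)
Lemma Re_mulJ z w :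
  `|complex.Re (z * w^*)| <= sqn z + sqn w.
Proof.
case: z w => [a b] [c d]; rewrite /sqn /= ler_norml.
have [h1 h2 h3 h4] := And4 (sqr_ge0 (a - c)) (sqr_ge0 (a + c))
  (sqr_ge0 (b - d)) (sqr_ge0 (b + d)).
have [h5 h6] := conj (addr_ge0 (sqr_ge0 a) (sqr_ge0 b)) (addr_ge0 (sqr_ge0 c) (sqr_ge0 d)).
by apply/andP; split; nra.
Qed.

Lemma Im_mulJ z w :
  `|complex.Im (z * w^*)| <= sqn z + sqn w.
Proof.
case: z w => [a b] [c d]; rewrite /sqn /= ler_norml.
have [h1 h2 h3 h4] := And4 (sqr_ge0 (a - d)) (sqr_ge0 (a + d))
  (sqr_ge0 (b - c)) (sqr_ge0 (b + c)).
have [h5 h6] := conj (addr_ge0 (sqr_ge0 a) (sqr_ge0 b)) (addr_ge0 (sqr_ge0 c) (sqr_ge0 d)).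
by apply/andP; split; nra.
Qed.

Lemma complexP z w : complex.Re z = complex.Re w ->
  complex.Im z = complex.Im w -> z = w.
Proof. by case: z w => [a b] [c d] /= -> ->. Qed.

Lemma cReD z w : complex.Re (z + w) = complex.Re z + complex.Re w.
Proof. by case: z w => [a b] [c d]. Qed.

Lemma cImD z w : complex.Im (z + w) = complex.Im z + complex.Im w.
Proof. by case: z w => [a b] [c d]. Qed.

Lemma cReM z w : complex.Re (z * w) =
  complex.Re z * complex.Re w - complex.Im z * complex.Im w.
Proof. by case: z w => [a b] [c d]. Qed.

Lemma cImM z w : complex.Im (z * w) =
  complex.Re z * complex.Im w + complex.Im z * complex.Re w.
Proof. by case: z w => [a b] [c d]. Qed.

Lemma cReJ z : complex.Re z^* = complex.Re z.
Proof. by case: z. Qed.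

Lemma cImJ z : complex.Im z^* = - complex.Im z.
Proof. by case: z. Qed.

Lemma cJM z w : (z * w)^* = z^* * w^*.
Proof. exact: rmorphM. Qed.

Lemma cJD z w : (z + w)^* = z^* + w^*.
Proof. exact: rmorphD. Qed.

Lemma cJN z : (- z)^* = - z^*.
Proof. exact: rmorphN. Qed.

Lemma cJX z n : (z ^+ n)^* = (z^*) ^+ n.
Proof. exact: rmorphXn. Qed.

Lemma conj_realC (x : R) : (x%:C)^* = x%:C.
Proof. by apply: complexP; rewrite /= ?oppr0. Qed.

Lemma expiD (s t : R) : expi (s + t) = expi s * expi t.
Proof. by apply: complexP; rewrite /expi /= ?cosD ?sinD; ring. Qed.

Lemma expi0 : expi (0 : R) = 1.
Proof. by rewrite /expi cos0 sin0. Qed.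

Lemma expiN (t : R) : expi (- t) = (expi t)^*.
Proof. by rewrite /expi cosN sinN. Qed.

Lemma sqn_expi (t : R) : sqn (expi t) = 1.
Proof. by rewrite /sqn /= cos2Dsin2. Qed.

Lemma expi_nat (n : nat) (t : R) : expi (n%:R * t) = expi t ^+ n.
Proof.
elim: n => [|n IH]; first by rewrite mul0r expi0 expr0.
by rewrite exprS -IH -expiD; congr expi; rewrite -[n.+1%:R]natr1; ring.
Qed.

Lemma expi_2pi_int (k : int) : expi (2 * pi * k%:~R) = 1 :> R[i].
Proof.
have H (n : nat) : expi (2 * pi * n%:R) = 1 :> R[i].
  rewrite mulrC expi_nat.
  have -> : expi (2 * pi) = 1 :> R[i].
    by rewrite mulr_natl /expi cos2pi sin2pi.
  by rewrite expr1n.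
case: k => n; first by rewrite -pmulrn.
by rewrite NegzE mulrNz mulrN expiN -pmulrn H rmorph1.
Qed.

End Complex.
Arguments sqn : simpl never.
(** * Square-integrable functions *)

Section L2.
Variable R : realType.
Local Notation mu := (@lebesgue_measure R).
Implicit Types f g h : R -> R[i].

Definition cmeas f :=
  measurable_fun [set: R] (re_fun f) /\ measurable_fun [set: R] (im_fun f).

Definition cintegrable f :=
  mu.-integrable setT (EFin \o re_fun f) /\
  mu.-integrable setT (EFin \o im_fun f).

Definition N2 f : \bar R := \int[mu]_x (sqn (f x))%:E.

Definition L2 f := cmeas f /\ (N2 f < +oo)%E.

Definition nm f : R := fine (N2 f).

Lemma cmeas_cst c : cmeas (fun=> c).
Proof. by split; exact: measurable_cst. Qed.

Lemma cmeasD f g : cmeas f -> cmeas g -> cmeas (fun x => f x + g x).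
Proof.
move=> [f1 f2] [g1 g2]; split.
- rewrite (_ : re_fun _ = re_fun f \+ re_fun g); first exact: measurable_funD.
  by apply/funext => x; rewrite /re_fun /= cReD.
- rewrite (_ : im_fun _ = im_fun f \+ im_fun g); first exact: measurable_funD.
  by apply/funext => x; rewrite /im_fun /= cImD.
Qed.

Lemma cmeasM f g : cmeas f -> cmeas g -> cmeas (fun x => f x * g x).
Proof.
move=> [f1 f2] [g1 g2]; split.
- rewrite (_ : re_fun _ =
    (re_fun f \* re_fun g) \- (im_fun f \* im_fun g)).
    by apply: measurable_funB; exact: measurable_funM.
  by apply/funext => x; rewrite /re_fun /= cReM.
- rewrite (_ : im_fun _ =
    (re_fun f \* im_fun g) \+ (im_fun f \* re_fun g)).
    by apply: measurable_funD; exact: measurable_funM.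
  by apply/funext => x; rewrite /im_fun /= cImM.
Qed.

Lemma cmeasZ c f : cmeas f -> cmeas (fun x => c * f x).
Proof. by move=> mf; apply: cmeasM => //; exact: cmeas_cst. Qed.

Lemma cmeasN f : cmeas f -> cmeas (fun x => - f x).
Proof.
move=> mf; rewrite (_ : (fun x => _) = fun x => - 1 * f x).
  exact: cmeasZ.
by apply/funext => x; rewrite mulN1r.
Qed.

Lemma cmeasB f g : cmeas f -> cmeas g -> cmeas (fun x => f x - g x).
Proof. by move=> mf mg; apply: cmeasD => //; exact: cmeasN. Qed.

Lemma cmeasJ f : cmeas f -> cmeas (fun x => (f x)^*).
Proof.
move=> [f1 f2]; split.
- by rewrite (_ : re_fun _ = re_fun f)//; apply/funext => x; rewrite /re_fun cReJ.
- rewrite (_ : im_fun _ = \- im_fun f); first exact: measurableT_comp.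
  by apply/funext => x; rewrite /im_fun cImJ.
Qed.

Lemma cmeas_real (h : R -> R) : measurable_fun setT h ->
  cmeas (fun x => (h x)%:C).
Proof. by move=> mh; split => //; exact: measurable_cst. Qed.

Lemma cmeas_comp f (h : R -> R) : cmeas f -> measurable_fun setT h ->
  cmeas (f \o h).
Proof. by move=> [f1 f2] mh; split; [exact: (measurableT_comp f1 mh)|exact: (measurableT_comp f2 mh)]. Qed.

Lemma cmeas_expi : cmeas (@expi R).
Proof.
split; apply: continuous_measurable_fun.
- exact: continuous_cos.
- exact: continuous_sin.
Qed.

Lemma cmeas_expi_comp (h : R -> R) : measurable_fun setT h ->
  cmeas (fun x => expi (h x)).
Proof. exact/cmeas_comp/cmeas_expi. Qed.

Lemma measurable_sqn f : cmeas f -> measurable_fun setT (fun x => sqn (f x)).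
Proof.
by move=> [f1 f2]; apply: measurable_funD; exact: measurable_funX.
Qed.

Lemma emeasurable_sqn f : cmeas f ->
  measurable_fun setT (fun x => (sqn (f x))%:E).
Proof. by move=> /measurable_sqn mf; exact/measurable_EFinP. Qed.

Lemma N2_ge0 f : (0 <= N2 f)%E.
Proof. by apply: integral_ge0 => x _; rewrite lee_fin sqn_ge0. Qed.

Lemma le_N2 f g : cmeas f -> cmeas g ->
  (forall x, sqn (f x) <= sqn (g x)) -> (N2 f <= N2 g)%E.
Proof.
move=> mf mg fg; apply: ge0_le_integral => //.
- by move=> x _; rewrite lee_fin sqn_ge0.
- exact: emeasurable_sqn.
- exact: emeasurable_sqn.
- by move=> x _; rewrite lee_fin.
Qed.

Lemma N2D_le (t : R) f g : 0 < t -> cmeas f -> cmeas g ->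
  (N2 (fun x => f x + g x)%R <= (1 + t)%:E * N2 f + (1 + t^-1)%:E * N2 g)%E.
Proof.
move=> t0 mf mg.
have t1 : 0 <= 1 + t by rewrite addr_ge0// ltW.
have t2 : 0 <= 1 + t^-1 by rewrite addr_ge0// invr_ge0 ltW.
have Zint (a : R) h : 0 <= a -> cmeas h ->
    (a%:E * N2 h = \int[mu]_x (a%:E * (sqn (h x))%:E))%E.
  move=> a0 mh; rewrite /N2 ge0_integralZl//; first exact: emeasurable_sqn.
  by move=> x _; rewrite lee_fin sqn_ge0.
rewrite !Zint//.
rewrite -ge0_integralD//.
- apply: ge0_le_integral => //.
  + by move=> x _; rewrite lee_fin sqn_ge0.
  + by apply: emeasurable_sqn; exact: cmeasD.
  + by apply: emeasurable_funD; apply: measurable_funeM; exact: emeasurable_sqn.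
  + by move=> x _; rewrite -!EFinM -EFinD lee_fin sqnD_le.
- by move=> x _; rewrite -EFinM lee_fin mulr_ge0// sqn_ge0.
- by apply: measurable_funeM; exact: emeasurable_sqn.
- by move=> x _; rewrite -EFinM lee_fin mulr_ge0// sqn_ge0.
- by apply: measurable_funeM; exact: emeasurable_sqn.
Qed.

Lemma N2Z c f : cmeas f ->
  N2 (fun x => c * f x) = ((sqn c)%:E * N2 f)%E.
Proof.
move=> mf; rewrite /N2; under eq_integral do rewrite sqnM EFinM.
rewrite ge0_integralZl ?lee_fin ?sqn_ge0//; first exact: emeasurable_sqn.
by move=> x _; rewrite lee_fin sqn_ge0.
Qed.

Lemma N20 : N2 (fun=> 0) = 0%E.
Proof. by rewrite /N2 sqn0 integral0. Qed.

Lemma L2_fin f : L2 f -> N2 f = (nm f)%:E.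
Proof. by move=> [_ f1]; rewrite /nm fineK// ge0_fin_numE// N2_ge0. Qed.

Lemma nm_ge0 f : 0 <= nm f.
Proof. by rewrite /nm fine_ge0// N2_ge0. Qed.

Lemma L20 : L2 (fun=> 0).
Proof. by split; [exact: cmeas_cst|rewrite N20 ltry]. Qed.

Lemma L2D f g : L2 f -> L2 g -> L2 (fun x => f x + g x).
Proof.
move=> [mf Nf] [mg Ng]; split; first exact: cmeasD.
apply: le_lt_trans (N2D_le ltr01 mf mg) _.
by rewrite lte_add_pinfty// lte_mul_pinfty.
Qed.

Lemma nmD_le (t : R) f g : 0 < t -> L2 f -> L2 g ->
  nm (fun x => f x + g x) <= (1 + t) * nm f + (1 + t^-1) * nm g.
Proof.
move=> t0 f2 g2; rewrite -lee_fin EFinD !EFinM -!L2_fin//; last exact: L2D.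
by apply: N2D_le => //; [case: f2|case: g2].
Qed.

Lemma L2Z c f : L2 f -> L2 (fun x => c * f x).
Proof.
move=> [mf Nf]; split; first exact: cmeasZ.
by rewrite N2Z// lte_mul_pinfty// lee_fin sqn_ge0.
Qed.

Lemma nmZ c f : L2 f -> nm (fun x => c * f x) = sqn c * nm f.
Proof.
move=> f2; apply: EFin_inj; rewrite EFinM -!L2_fin//; last exact: L2Z.
by rewrite N2Z//; case: f2.
Qed.

Lemma L2N f : L2 f -> L2 (fun x => - f x).
Proof.
move=> mf; rewrite (_ : (fun x => _) = fun x => - 1 * f x).
  exact: L2Z.
by apply/funext => x; rewrite mulN1r.
Qed.

Lemma L2B f g : L2 f -> L2 g -> L2 (fun x => f x - g x).
Proof. by move=> mf mg; apply: L2D => //; exact: L2N. Qed.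

Lemma L2_sum (I : Type) (s : seq I) (F : I -> R -> R[i]) :
  (forall i, L2 (F i)) -> L2 (fun x => \sum_(i <- s) F i x).
Proof.
move=> F2; elim: s => [|i s IH].
  by under eq_fun do rewrite big_nil; exact: L20.
by under eq_fun do rewrite big_cons; exact: L2D.
Qed.

Lemma L2_le f g : cmeas f -> L2 g -> (forall x, sqn (f x) <= sqn (g x)) ->
  L2 f.
Proof.
by move=> mf [mg g2] fg; split => //; apply: le_lt_trans g2; exact: le_N2.
Qed.

Lemma nmN f : nm (fun x => - f x) = nm f.
Proof. by rewrite /nm /N2; under eq_integral do rewrite sqnN. Qed.

Lemma nmBC f g : nm (fun x => f x - g x) = nm (fun x => g x - f x).
Proof. by rewrite -nmN; congr nm; apply/funext => x; rewrite opprB. Qed.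

Lemma L2_unimodularM h f : cmeas h -> (forall x, sqn (h x) = 1) -> L2 f ->
  L2 (fun x => h x * f x).
Proof.
move=> mh h1 f2; apply: (L2_le _ f2); first by apply: cmeasM => //; case: f2.
by move=> x; rewrite sqnM h1 mul1r.
Qed.

Lemma nm_unimodularM h f : (forall x, sqn (h x) = 1) ->
  nm (fun x => h x * f x) = nm f.
Proof.
by move=> h1; congr fine; apply: eq_integral => x _; rewrite sqnM h1 mul1r.
Qed.

Lemma cintegrable_meas f : cintegrable f -> cmeas f.
Proof.
by move=> [/measurable_int/measurable_EFinP ? /measurable_int/measurable_EFinP].
Qed.

Lemma cintegrableD f g : cintegrable f -> cintegrable g ->
  cintegrable (fun x => f x + g x).
Proof.
move=> [f1 f2] [g1 g2]; split.
- rewrite (_ : EFin \o _ = (EFin \o re_fun f) \+ (EFin \o re_fun g))%E.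
    exact: integrableD.
  by apply/funext => x; rewrite /= -EFinD /re_fun /= cReD.
- rewrite (_ : EFin \o _ = (EFin \o im_fun f) \+ (EFin \o im_fun g))%E.
    exact: integrableD.
  by apply/funext => x; rewrite /= -EFinD /im_fun /= cImD.
Qed.

Lemma cintegrableZ c f : cintegrable f -> cintegrable (fun x => c * f x).
Proof.
move=> [f1 f2]; split.
- rewrite (_ : EFin \o _ = (fun x => (complex.Re c)%:E * (re_fun f x)%:E)
    \- (fun x => (complex.Im c)%:E * (im_fun f x)%:E))%E.
    by apply: integrableB => //; exact: integrableZl.
  by apply/funext => x; rewrite /= -!EFinM -EFinB /re_fun /= cReM.
- rewrite (_ : EFin \o _ = (fun x => (complex.Re c)%:E * (im_fun f x)%:E)
    \+ (fun x => (complex.Im c)%:E * (re_fun f x)%:E))%E.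
    by apply: integrableD => //; exact: integrableZl.
  by apply/funext => x; rewrite /= -!EFinM -EFinD /im_fun /= cImM.
Qed.

Lemma cintegrable0 : cintegrable (fun=> 0).
Proof. by split; exact: integrable0. Qed.

Lemma cintegrable_sum (I : Type) (s : seq I) (F : I -> R -> R[i]) :
  (forall i, cintegrable (F i)) -> cintegrable (fun x => \sum_(i <- s) F i x).
Proof.
move=> F2; elim: s => [|i s IH].
  by under eq_fun do rewrite big_nil; exact: cintegrable0.
by under eq_fun do rewrite big_cons; exact: cintegrableD.
Qed.

Lemma cintegrable_le f (g : R -> R) : cmeas f ->
  mu.-integrable setT (EFin \o g) ->
  (forall x, `|complex.Re (f x)| <= g x) ->
  (forall x, `|complex.Im (f x)| <= g x) -> cintegrable f.
Proof.
move=> [f1 f2] gi fg1 fg2; split.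
- apply: (le_integrable _ _ _ gi) => //; first exact/measurable_EFinP.
  by move=> x _; rewrite /= lee_fin (le_trans (fg1 _))// ler_norm.
- apply: (le_integrable _ _ _ gi) => //; first exact/measurable_EFinP.
  by move=> x _; rewrite /= lee_fin (le_trans (fg2 _))// ler_norm.
Qed.

Lemma cintegralD f g : cintegrable f -> cintegrable g ->
  cintegral (fun x => f x + g x) = cintegral f + cintegral g.
Proof.
move=> [f1 f2] [g1 g2]; apply: complexP.
- rewrite cReD /= -RintegralD//; apply: eq_Rintegral => x _.
  by rewrite /re_fun cReD.
- rewrite cImD /= -RintegralD//; apply: eq_Rintegral => x _.
  by rewrite /im_fun cImD.
Qed.

Lemma cintegralZ c f : cintegrable f ->
  cintegral (fun x => c * f x) = c * cintegral f.
Proof.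
move=> [f1 f2].
have Hi (a : R) (h : R -> R) : mu.-integrable setT (EFin \o h) ->
    mu.-integrable setT (EFin \o (fun x => a * h x)).
  move=> hi; rewrite (_ : EFin \o _ = fun x => a%:E * (EFin \o h) x)%E//.
  exact: integrableZl.
apply: complexP.
- rewrite cReM /= -!RintegralZl// -RintegralB//; try exact: Hi.
  by apply: eq_Rintegral => x _; rewrite /re_fun cReM.
- rewrite cImM /= -!RintegralZl// -RintegralD//; try exact: Hi.
  by apply: eq_Rintegral => x _; rewrite /im_fun cImM.
Qed.

Lemma cintegral0 : cintegral (fun=> 0) = 0 :> R[i].
Proof. by apply: complexP; rewrite /= /Rintegral integral0. Qed.

Lemma cintegral_sum (I : Type) (s : seq I) (F : I -> R -> R[i]) :
  (forall i, cintegrable (F i)) ->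
  cintegral (fun x => \sum_(i <- s) F i x) = \sum_(i <- s) cintegral (F i).
Proof.
move=> F2; elim: s => [|i s IH].
  by under eq_fun do rewrite big_nil; rewrite cintegral0 big_nil.
rewrite big_cons -IH -cintegralD//; last exact: cintegrable_sum.
by under eq_fun do rewrite big_cons.
Qed.

Lemma cintegralJ f : cintegrable f ->
  cintegral (fun x => (f x)^*) = (cintegral f)^*.
Proof.
move=> [f1 f2]; apply: complexP.
- by rewrite cReJ /=; apply: eq_Rintegral => x _; rewrite /re_fun cReJ.
- rewrite cImJ /= -mulN1r -RintegralZl//; apply: eq_Rintegral => x _.
  by rewrite /im_fun cImJ mulN1r.
Qed.

Lemma L2_sqn_integrable f : L2 f ->
  mu.-integrable setT (EFin \o (fun x => sqn (f x))).
Proof.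
move=> [mf f2]; apply/integrableP; split; first exact: emeasurable_sqn.
by under eq_integral => x _ do rewrite /= ger0_norm ?sqn_ge0//.
Qed.

Lemma cintegrable_mulJ f g : L2 f -> L2 g ->
  cintegrable (fun x => f x * (g x)^*).
Proof.
move=> f2 g2; apply: (@cintegrable_le _ (fun x => sqn (f x) + sqn (g x))).
- by apply: cmeasM; [case: f2|apply: cmeasJ; case: g2].
- rewrite (_ : EFin \o _ = (EFin \o (fun x => sqn (f x))) \+
    (EFin \o (fun x => sqn (g x))))%E; last first.
    by apply/funext => x /=; rewrite EFinD.
  by apply: integrableD => //; exact: L2_sqn_integrable.
- by move=> x; exact: Re_mulJ.
- by move=> x; exact: Im_mulJ.
Qed.

Lemma L2innerDl f g h : L2 f -> L2 g -> L2 h ->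
  L2inner (fun x => f x + g x) h = L2inner f h + L2inner g h.
Proof.
move=> f2 g2 h2; rewrite /L2inner -cintegralD; try exact: cintegrable_mulJ.
by congr cintegral; apply/funext => x; rewrite mulrDl.
Qed.

Lemma L2innerZl c f g : L2 f -> L2 g ->
  L2inner (fun x => c * f x) g = c * L2inner f g.
Proof.
move=> f2 g2; rewrite /L2inner -cintegralZ; last exact: cintegrable_mulJ.
by congr cintegral; apply/funext => x; rewrite mulrA.
Qed.

Lemma L2innerC f g : L2 f -> L2 g -> L2inner g f = (L2inner f g)^*.
Proof.
move=> f2 g2; rewrite /L2inner -cintegralJ; last exact: cintegrable_mulJ.
by congr cintegral; apply/funext => x; rewrite rmorphM /= conjCK mulrC.
Qed.

Lemma L2inner_self f : L2inner f f = (nm f)%:C.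
Proof.
apply: complexP; rewrite /=.
  by congr fine; apply: eq_integral => x _; rewrite /re_fun sqn_conjM.
rewrite /Rintegral integral0_eq// => x _.
by rewrite /im_fun sqn_conjM.
Qed.

Lemma nmD f g : L2 f -> L2 g -> nm (fun x => f x + g x) =
  nm f + nm g + 2 * complex.Re (L2inner f g).
Proof.
move=> f2 g2; have fg2 := L2D f2 g2.
have := L2inner_self (fun x => f x + g x).
rewrite L2innerDl// (L2innerC fg2 f2) (L2innerC fg2 g2) !L2innerDl//.
rewrite !L2inner_self (L2innerC f2 g2) => /(congr1 (@complex.Re _)).
by rewrite !(cReD, cReJ) /= => <-; ring.
Qed.

Lemma nmB f g : L2 f -> L2 g -> nm (fun x => f x - g x) =
  nm f + nm g - 2 * complex.Re (L2inner f g).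
Proof.
move=> f2 g2; rewrite nmD//; last exact: L2N.
have -> : (fun x => - g x) = (fun x => - 1 * g x).
  by apply/funext => x; rewrite mulN1r.
have -> : L2inner f (fun x => -1 * g x) = - L2inner f g.
  rewrite L2innerC//; last exact: L2Z.
  by rewrite L2innerZl// (L2innerC f2 g2) mulN1r rmorphN; congr (- _); exact: conjCK.
rewrite nmZ// sqnN sqn_real.
by case: (L2inner f g) => a b /=; ring.
Qed.

End L2.

(** * Comparison with the spaces [Lfun], orthogonal expansions, translation of the variable *)

Section L2Lp.
Variable R : realType.
Local Notation mu := (@lebesgue_measure R).
Implicit Types f g h : R -> R[i].

Lemma inLp2P f : inLp 2%:E f <-> L2 f.
Proof.
split.
- move=> [f1 f2].
  have mf1 : measurable_fun setT (re_fun f).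
    by move: f1; rewrite inE => /andP[]; rewrite inE.
  have mf2 : measurable_fun setT (im_fun f).
    by move: f2; rewrite inE => /andP[]; rewrite inE.
  split => //.
  rewrite /N2 (_ : (fun x => _) = (fun x => (re_fun f x ^+ 2)%:E + (im_fun f x ^+ 2)%:E)%E)//.
  apply: integrable_lty => //.
  by apply: integrableD => //; exact: Lfun2_integrable_sqr.
- move=> [[mf1 mf2] f2].
  have H (h : R -> R) : measurable_fun setT h ->
      (forall x, h x ^+ 2 <= sqn (f x)) -> h \in Lfun mu 2%:E.
    move=> mh hf; rewrite inE; apply/andP; split; rewrite inE//=.
    rewrite /finite_norm unlock; apply: poweR_lty; apply: le_lt_trans f2.
    rewrite (eq_integral (fun x : measurableTypeR R => (h x ^+ 2)%:E)); last first.
      by move=> x _; rewrite /= powR_mulrn// real_normK ?num_real.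
    apply: ge0_le_integral => //.
    + by move=> x _; rewrite lee_fin sqr_ge0.
    + by apply/measurable_EFinP; exact: measurable_funX.
    + exact: emeasurable_sqn.
    + by move=> x _; rewrite lee_fin.
  by split; apply: H => // x; rewrite /sqn ?lerDl ?lerDr sqr_ge0.
Qed.

Lemma inLp1P f : inLp 1%:E f <-> cintegrable f.
Proof. by split => -[/Lfun1_integrable f1 /Lfun1_integrable f2]; split. Qed.

Lemma L2distE f g : L2 (fun x => f x - g x) ->
  L2dist f g = (Num.sqrt (nm (fun x => f x - g x)))%:E.
Proof.
move=> fg2; rewrite -powR12_sqrt ?nm_ge0// -poweR_EFin -L2_fin//.
rewrite /L2dist unlock; congr (poweR _ _).
apply: eq_integral => x _.
by rewrite /= ger0_norm ?cabs_ge0// powR_mulrn ?cabs_ge0// sqr_cabs.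
Qed.

Lemma L2dist_cvg0 (f_ : nat -> R -> R[i]) f :
  (forall n, L2 (fun x => f_ n x - f x)) ->
  L2dist (f_ n) f @[n --> \oo] --> 0%E <->
  nm (fun x => f_ n x - f x) @[n --> \oo] --> (0 : R).
Proof.
move=> h2; under eq_fun do rewrite L2distE//; split => [H|H].
- have {}H : Num.sqrt (nm (fun x => f_ n x - f x)) @[n --> \oo] --> (0 : R).
    by move/fine_cvgP: H => [].
  have -> : (fun n => nm (fun x => f_ n x - f x)) =
      (fun n => Num.sqrt (nm (fun x => f_ n x - f x)) *
                Num.sqrt (nm (fun x => f_ n x - f x))).
    by apply/funext => n; rewrite -expr2 sqr_sqrtr// nm_ge0.
  by have := cvgM H H; rewrite mulr0; apply.
- apply: cvg_EFin; first by apply: nearW.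
  have := @continuous_cvg _ _ _ _ _ _ _ _ (@sqrt_continuous R 0) H.
  by rewrite sqrtr0; apply.
Qed.

Lemma nm_cvg (f_ : nat -> R -> R[i]) f : (forall n, L2 (f_ n)) -> L2 f ->
  nm (fun x => f_ n x - f x) @[n --> \oo] --> (0 : R) ->
  nm (f_ n) @[n --> \oo] --> nm f.
Proof.
move=> fn2 f2 H; apply/cvgrPdist_lt => e e0.
(* With this [t] the term [t * nm f] costs less than [e / 2]; the [+ 1] covers [nm f = 0]. The other
   half of [e] pays for [(1 + t^-1)] times the squared distance. *)
pose t := e / 2 / (nm f + 1).
have nf1 : 0 < nm f + 1 by rewrite ltr_wpDl ?nm_ge0.
have t0 : 0 < t by rewrite !divr_gt0.
have tnf : t * nm f < e / 2.
  rewrite /t mulrAC ltr_pdivrMr// ltr_pM2l ?divr_gt0//.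
  by rewrite ltrDl.
have ct : 0 < 1 + t^-1 by rewrite addr_gt0// invr_gt0.
have de : 0 < e / 2 / (1 + t^-1) by rewrite !divr_gt0.
move/cvgrPdist_lt : H => /(_ _ de) H; near=> n.
have : `|0 - nm (fun x => f_ n x - f x)| < e / 2 / (1 + t^-1) by near: n.
have h2 : L2 (fun x => f_ n x - f x) by exact: L2B.
rewrite sub0r normrN ger0_norm ?nm_ge0// ltr_pdivlMr// mulrC => Hn.
(* Used for both [f + h] and [f - h], with [h = f_ n - f], the inequality bounds the cross term
   [2 * Re <f, h>] from above and from below. *)
have H1 := nmD_le t0 f2 h2.
have H2 := nmD_le t0 f2 (L2N h2).
have H3 := nmD f2 h2; have H4 := nmB f2 h2.
rewrite nmN H4 in H2; rewrite {}H3 in H1.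
have Efn : nm (f_ n) = nm (fun x => f x + (f_ n x - f x)).
  by congr nm; apply/funext => x; rewrite addrC subrK.
rewrite nmD// in Efn.
move: Hn H1 H2 Efn; set u := nm (fun x => _ - _); set r := complex.Re _.
move=> Hn H1 H2 ->.
have u0 : 0 <= u by exact: nm_ge0.
have tu : 0 <= t^-1 * u by rewrite mulr_ge0// invr_ge0 ltW.
rewrite ltr_norml; apply/andP; split; lra.
Unshelve. all: by end_near. Qed.

Lemma nm_cvg_eq (f_ F_ : nat -> R -> R[i]) f F :
  (forall n, L2 (f_ n)) -> (forall n, L2 (F_ n)) -> L2 f -> L2 F ->
  nm (fun x => f_ n x - f x) @[n --> \oo] --> (0 : R) ->
  nm (fun x => F_ n x - F x) @[n --> \oo] --> (0 : R) ->
  (forall n, nm (f_ n) = nm (F_ n)) -> nm f = nm F.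
Proof.
move=> fn2 Fn2 f2 F2 H1 H2 E.
have c1 := nm_cvg fn2 f2 H1; have c2 := nm_cvg Fn2 F2 H2.
have E' : (fun n => nm (f_ n)) = (fun n => nm (F_ n)) by apply/funext.
by rewrite E' in c1; exact: (cvg_unique _ c1 c2).
Qed.

(** Expanding the squared norms for [a = 1] and for [a] the imaginary unit isolates the real and the
    imaginary part of the inner product. *)
Lemma polarization f g F G : L2 f -> L2 g -> L2 F -> L2 G ->
  nm f = nm F -> nm g = nm G ->
  (forall a : R[i], nm (fun x => f x + a * g x) = nm (fun x => F x + a * G x)) ->
  L2inner f g = L2inner F G.
Proof.
move=> f2 g2 F2 G2 nf ng H.
have Zr a u v : L2 u -> L2 v ->
    L2inner u (fun x => a * v x) = a^* * L2inner u v.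
  move=> u2 v2; rewrite L2innerC//; last exact: L2Z.
  rewrite L2innerZl// (L2innerC u2 v2) rmorphM; congr (_ * _); exact: conjCK.
have key a : complex.Re (a^* * L2inner f g) = complex.Re (a^* * L2inner F G).
  have := H a; rewrite !nmD//; try exact: L2Z.
  by rewrite !nmZ// !Zr// nf ng; lra.
have k1 := key (1 +i* 0); have ki := key (0 +i* 1).
move: k1 ki; case: (L2inner f g) (L2inner F G) => [a b] [c d] /= k1 ki.
by apply: complexP => /=; lra.
Qed.

(** Completing the square, for orthogonal vectors of common squared norm [L]. The optimal [d]
    annihilates the last sum, which gives Bessel's inequality; for any other [d] that sum is
    nonnegative, which gives best approximation. The induction subtracts one vector at a time: by
    orthogonality the remaining coefficients do not change. *)
Lemma nm_sub_lincomb (I : eqType) (L : R) (E : I -> R -> R[i])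
    (d : I -> R[i]) (s : seq I) g : 0 < L -> uniq s ->
  (forall i, L2 (E i)) -> L2 g ->
  (forall i j, L2inner (E i) (E j) = (i == j)%:R * L%:C) ->
  nm (fun x => g x - \sum_(i <- s) d i * E i x) =
  nm g - \sum_(i <- s) sqn (L2inner g (E i)) / L
       + \sum_(i <- s) sqn (L2inner g (E i) - L%:C * d i) / L.
Proof.
move=> L0 + E2 + orth; elim: s g => [|i s IH] g /= us g2.
  by under eq_fun do rewrite big_nil subr0; rewrite !big_nil subr0 addr0.
case/andP: us => nis us.
have dE2 : L2 (fun x => d i * E i x) by exact: L2Z.
have g'2 := L2B g2 dE2.
have -> : (fun x => g x - \sum_(j <- i :: s) d j * E j x) =
    (fun x => (g x - d i * E i x) - \sum_(j <- s) d j * E j x).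
  by apply/funext => x; rewrite big_cons opprD addrA.
rewrite IH// nmB// nmZ//.
have nE : nm (E i) = L.
  have := L2inner_self (E i); rewrite orth eqxx mul1r.
  by move=> /(congr1 (@complex.Re _)) /= ->.
have ip : L2inner g (fun x => d i * E i x) = (d i)^* * L2inner g (E i).
  rewrite L2innerC// L2innerZl// (L2innerC g2 (E2 i)) rmorphM.
  by congr (_ * _); exact: conjCK.
have eqs j : j \in s -> L2inner (fun x => g x - d i * E i x) (E j) =
    L2inner g (E j).
  move=> js.
  have -> : (fun x => g x - d i * E i x) = (fun x => g x + (- d i) * E i x).
    by apply/funext => x; rewrite mulNr.
  rewrite L2innerDl//; last exact: L2Z.
  rewrite L2innerZl// orth; case: eqP => [ij|_]; last by rewrite mul0r mulr0 addr0.
  by rewrite ij js in nis.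
rewrite !big_cons.
rewrite (eq_big_seq (fun j => sqn (L2inner g (E j)) / L)); last first.
  by move=> j js; rewrite eqs.
rewrite [X in _ + X](eq_big_seq (fun j => sqn (L2inner g (E j) - L%:C * d j) / L)); last first.
  by move=> j js; rewrite eqs.
rewrite ip nE.
have -> : sqn (L2inner g (E i) - L%:C * d i) / L = sqn (L2inner g (E i)) / L
   + sqn (d i) * L - 2 * complex.Re ((d i)^* * L2inner g (E i)).
  case: (L2inner g (E i)) (d i) => [a b] [c e]; rewrite /sqn /=.
  by field; rewrite gt_eqF.
ring.
Qed.

Lemma lebesgue_measure_shift (c : R) (A : set R) : measurable A ->
  pushforward mu (+%R^~ c : _ -> measurableTypeR R) A = mu A.
Proof.
move=> mA; apply/esym/lebesgue_measure_unique => //=.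
  by apply: measurable_funD => //; exact: measurable_cst.
move=> _ _ [[a b]] _ <-; rewrite /pushforward.
have -> : +%R^~ c @^-1` `]a, b] = `]a - c, b - c]%classic.
  by apply/seteqP; split => x /=; rewrite !in_itv /= ltrBlDr lerBrDr.
rewrite !lebesgue_measure_itv/= !lte_fin ltrD2r.
by case: ifP => // _; rewrite -!EFinB; congr (_%:E); ring.
Qed.

Lemma ge0_integral_shift (c : R) (D : set R) (f : R -> \bar R) :
  measurable D -> measurable_fun D f -> (forall x, D x -> 0 <= f x)%E ->
  (\int[mu]_(x in +%R^~ c @^-1` D) f (x + c)%R = \int[mu]_(x in D) f x)%E.
Proof.
move=> mD mf f0.
transitivity (\int[pushforward mu (+%R^~ c : _ -> measurableTypeR R)]_(x in D) f x)%E.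
  rewrite ge0_integral_pushforward//.
    by apply: measurable_funD => //; exact: measurable_cst.
  by move=> x; rewrite inE; exact: f0.
apply: eq_measure_integral; first by apply: measurable_funD => //; exact: measurable_cst.
by move=> ? A mA _; exact: lebesgue_measure_shift.
Qed.

Lemma integralT_shift (c : R) (f : R -> \bar R) : measurable_fun setT f ->
  (\int[mu]_x f (x + c)%R = \int[mu]_x f x)%E.
Proof.
move=> mf; rewrite integralE [RHS]integralE; congr (_ - _)%E.
  rewrite -[RHS](@ge0_integral_shift c)//; last exact: measurable_funepos.
  by rewrite preimage_setT; apply: eq_integral => x _; rewrite -[RHS]/((f^\+ \o +%R^~ c) x)%E -funepos_comp.
rewrite -[RHS](@ge0_integral_shift c)//; last exact: measurable_funeneg.
by rewrite preimage_setT; apply: eq_integral => x _; rewrite -[RHS]/((f^\- \o +%R^~ c) x)%E -funeneg_comp.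
Qed.

Lemma cintegral_shift (c : R) (f : R -> R[i]) : cmeas f ->
  cintegral (fun x => f (x + c)) = cintegral f.
Proof.
move=> [mf1 mf2]; rewrite /cintegral /Rintegral.
rewrite -(@integralT_shift c (fun x => (re_fun f x)%:E)); last exact/measurable_EFinP.
by rewrite -(@integralT_shift c (fun x => (im_fun f x)%:E))//; exact/measurable_EFinP.
Qed.

Lemma N2_shift (c : R) (f : R -> R[i]) : cmeas f ->
  N2 (fun x => f (x + c)) = N2 f.
Proof.
move=> mf; rewrite /N2 -(@integralT_shift c (fun x => (sqn (f x))%:E))//.
exact: emeasurable_sqn.
Qed.

Lemma cmeas_shift (c : R) f : cmeas f -> cmeas (fun x => f (x + c)).
Proof.
move=> mf; apply: (cmeas_comp mf).
by apply: measurable_funD => //; exact: measurable_cst.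
Qed.

Lemma L2_shift (c : R) f : L2 f -> L2 (fun x => f (x + c)).
Proof. by move=> [mf f2]; split; [exact: cmeas_shift|rewrite N2_shift]. Qed.

Lemma cintegrable_shift (c : R) f : cintegrable f ->
  cintegrable (fun x => f (x + c)).
Proof.
move=> fi; have mf := cintegrable_meas fi.
case: fi => /integrableP[m1 i1] /integrableP[m2 i2].
have [n1 n2] := cmeas_shift c mf.
split; apply/integrableP; split; try exact/measurable_EFinP.
- rewrite (@integralT_shift c (fun x => `|(re_fun f x)%:E|)%E)//.
  exact: measurableT_comp.
- rewrite (@integralT_shift c (fun x => `|(im_fun f x)%:E|)%E)//.
  exact: measurableT_comp.
Qed.

End L2Lp.
(** * Fourier series on an interval *)

Section TrigInterval.
Variable R : realType.
Local Notation mu := (@lebesgue_measure R).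
Implicit Types f g h : R -> R[i].

(** The phase [t] lets one formula serve both parts of an exponential, since sin u = cos (u - pi /
    2). *)
Lemma integral_cos_affine (w t a b : R) : w != 0 -> a < b ->
  (\int[mu]_(x in `]a, b[) (cos (w * x + t))%:E =
   (sin (w * b + t) / w - sin (w * a + t) / w)%:E)%E.
Proof.
move=> w0 ab.
have dF (x : R) : is_derive x 1 (fun x => sin (w * x + t) / w) (cos (w * x + t)).
  apply: is_derive_eq.
  by rewrite scaler0 add0r addr0 /GRing.scale /= mulr1; field.
have cf : continuous (fun x : R => cos (w * x + t)).
  move=> x; apply: continuous_comp; last exact: continuous_cos.
  by apply: continuousD; [exact: mulrl_continuous|exact: cst_continuous].
rewrite -(@integral_itv_bndoo _ _ _ _ true false); last first.
  by apply/measurable_EFinP/measurable_funTS; exact: continuous_measurable_fun.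
rewrite (@continuous_FTC2 _ _ (fun x => sin (w * x + t) / w))// ?EFinB//.
- exact: continuous_subspaceT.
- have cF (x : R) : {for x, continuous (fun x => sin (w * x + t) / w)}.
    by apply: differentiable_continuous; apply/derivable1_diffP.
  split.
  + by move=> x _.
  + exact/cvg_at_right_filter/cF.
  + exact/cvg_at_left_filter/cF.
- by move=> x _; rewrite derive1E derive_val.
Qed.

Lemma integral_cos_period (n : int) (t a L : R) : n != 0 -> 0 < L ->
  (\int[mu]_(x in `]a, (a + L)%R[) (cos (2 * pi * n%:~R / L * x + t))%:E = 0)%E.
Proof.
move=> n0 L0; rewrite integral_cos_affine ?ltrDl//; last first.
  by rewrite !mulf_eq0 invr_eq0 intr_eq0 (negbTE n0) !gt_eqF ?pi_gt0.
have -> : 2 * pi * n%:~R / L * (a + L) + t =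
    (2 * pi * n%:~R / L * a + t) + 2 * pi * n%:~R.
  by field; rewrite gt_eqF.
have /(congr1 (@complex.Im R)) := expiD (2 * pi * n%:~R / L * a + t) (2 * pi * n%:~R).
by rewrite expi_2pi_int mulr1 /= => ->; rewrite subrr.
Qed.

Lemma cintegral_indic (D : set R) (f : R -> R[i]) : measurable D ->
  cintegral (fun x => (\1_D x)%:C * f x) =
  (\int[mu]_(x in D) re_fun f x) +i* (\int[mu]_(x in D) im_fun f x).
Proof.
move=> mD; rewrite /cintegral; congr (_ +i* _); rewrite [RHS]Rintegral_mkcond;
  apply: eq_Rintegral => x _; rewrite patchE /re_fun /im_fun indicE.
  by rewrite cReM /= mul0r subr0; case: ifP; rewrite (mul1r, mul0r).
by rewrite cImM /= mul0r addr0; case: ifP; rewrite (mul1r, mul0r).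
Qed.

End TrigInterval.

(** * Trigonometric polynomials of period [L] *)

Section TrigPolynomials.
Variables (R : realType) (a L : R).
Hypothesis L0 : 0 < L.
Local Notation mu := (@lebesgue_measure R).
Implicit Types f g h : R -> R[i].
Local Notation D := `]a, (a + L)[%classic.

Definition trig (k : int) (x : R) : R[i] := expi (2 * pi * k%:~R / L * x).

(** Extension by zero: Fourier series on an interval then take place inside L2 of the line. *)
Definition itrig (k : int) (x : R) : R[i] := (\1_D x)%:C * trig k x.

Lemma trigD k l x : trig (k + l) x = trig k x * trig l x.
Proof. by rewrite /trig -expiD rmorphD /=; congr expi; ring. Qed.

Lemma trigN k x : trig (- k) x = (trig k x)^*.
Proof. by rewrite /trig -expiN rmorphN /=; congr expi; ring. Qed.

Lemma trig0 x : trig 0 x = 1.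
Proof. by rewrite /trig mulr0 !mul0r expi0. Qed.

Lemma trig_nat (n : nat) x : trig n%:Z x = trig 1 x ^+ n.
Proof.
by rewrite /trig -expi_nat; congr expi; rewrite -pmulrn; ring.
Qed.

Lemma sqn_trig k x : sqn (trig k x) = 1.
Proof. exact: sqn_expi. Qed.

Lemma cmeas_trig k : cmeas (trig k).
Proof.
apply: cmeas_expi_comp; apply: continuous_measurable_fun.
exact: mulrl_continuous.
Qed.

Lemma cmeas_indic (A : set R) : measurable A ->
  cmeas (fun x => (\1_A x)%:C : R[i]).
Proof. by move=> mA; apply: cmeas_real; exact: measurable_indic. Qed.

Lemma mu_itv : mu D = L%:E.
Proof.
by rewrite lebesgue_measure_itv /= lte_fin ltrDl L0 -EFinB; congr EFin; ring.
Qed.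

Lemma sqn_indic (A : set R) x : sqn ((\1_A x)%:C : R[i]) = \1_A x.
Proof. by rewrite sqn_real indicE; case: (_ \in _); rewrite ?expr1n ?expr0n. Qed.

Lemma L2_indic_le (A : set R) f : measurable A -> A `<=` D -> cmeas f ->
  (forall x, sqn (f x) <= 1) ->  L2 (fun x => (\1_A x)%:C * f x).
Proof.
move=> mA AD mf f1; split; first by apply: cmeasM => //; exact: cmeas_indic.
apply: (@le_lt_trans _ _ (\int[mu]_x (\1_D x)%:E)%E).
  apply: ge0_le_integral => //.
  - by move=> x _; rewrite lee_fin sqn_ge0.
  - by apply: emeasurable_sqn; apply: cmeasM => //; exact: cmeas_indic.
  - exact/measurable_EFinP/measurable_indic.
  - move=> x _; rewrite lee_fin sqnM sqn_indic !indicE.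
    have [xA|] := boolP (x \in A); last by rewrite mul0r.
    by rewrite mul1r mem_set ?f1//; apply: AD; rewrite inE in xA.
by rewrite integral_indic// setIT [X in (X < _)%E]mu_itv ltry.
Qed.

Lemma L2_itrig k : L2 (itrig k).
Proof.
by apply: L2_indic_le => //; [exact: cmeas_trig|move=> x; rewrite sqn_trig].
Qed.

Lemma itrig_orthogonal k l : L2inner (itrig k) (itrig l) = (k == l)%:R * L%:C.
Proof.
have -> : L2inner (itrig k) (itrig l) =
    cintegral (fun x => (\1_D x)%:C * trig (k - l) x).
  congr cintegral; apply/funext => x.
  rewrite /itrig cJM trigD trigN conj_realC mulrACA; congr (_ * _).
  by rewrite indicE; case: (_ \in _); rewrite ?mulr1 ?mulr0.
have [->|kl] := eqVneq k l.
  rewrite subrr cintegral_indic// mul1r; apply: complexP => /=.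
    rewrite (@eq_Rintegral _ _ _ _ _ (cst 1)); last first.
      by move=> x _; rewrite /re_fun trig0.
    by rewrite Rintegral_cst// [X in fine X]mu_itv mul1r.
  rewrite (@eq_Rintegral _ _ _ _ _ (cst 0)); last first.
    by move=> x _; rewrite /im_fun trig0.
  by rewrite Rintegral_cst// mul0r.
rewrite mul0r cintegral_indic//; have kl0 : k - l != 0 by rewrite subr_eq0.
apply: complexP => /=.
  have /(congr1 fine) := @integral_cos_period R _ 0 a L kl0 L0.
  rewrite -/(Rintegral _ _ _) /=  => <-.
  by apply: eq_Rintegral => x _; rewrite addr0.
have /(congr1 fine) := @integral_cos_period R _ (- (pi / 2)) a L kl0 L0.
rewrite -/(Rintegral _ _ _) /=  => <-.
by apply: eq_Rintegral => x _; rewrite cosBpihalf.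
Qed.

(** Laurent polynomials in [trig 1], whose conjugate is its inverse. In this form products and
    powers are immediate, as needed to substitute a cosine into [bump]. *)
Definition trigpoly f := exists (p : {poly R[i]}) (n : nat),
  forall x, f x = (trig 1 x)^* ^+ n * p.[trig 1 x].

Lemma trigpoly_cst c : trigpoly (fun=> c).
Proof. by exists c%:P, 0%N => x; rewrite expr0 mul1r hornerC. Qed.

Lemma conj_trigK x : (trig 1 x)^* * trig 1 x = 1.
Proof. by rewrite mulrC sqn_conjM sqn_trig. Qed.

Lemma trigpolyD f g : trigpoly f -> trigpoly g -> trigpoly (fun x => f x + g x).
Proof.
move=> [p [n pf]] [q [m qg]].
exists (p * 'X^m + q * 'X^n), (n + m)%N => x.
rewrite pf qg hornerD !hornerM !hornerXn exprD mulrDr.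
set e := trig 1 x; set e' := (e^*).
have ee k : e' ^+ k * e ^+ k = 1 by rewrite -exprMn conj_trigK expr1n.
congr (_ + _).
- by rewrite [p.[_] * _]mulrC mulrA -[_ * _ * e ^+ m]mulrA ee mulr1.
- by rewrite [e' ^+ n * _]mulrC [q.[_] * _]mulrC mulrA -[_ * _ * e ^+ n]mulrA ee mulr1.
Qed.

Lemma trigpolyM f g : trigpoly f -> trigpoly g -> trigpoly (fun x => f x * g x).
Proof.
move=> [p [n pf]] [q [m qg]]; exists (p * q), (n + m)%N => x.
by rewrite pf qg hornerM exprD mulrACA.
Qed.

Lemma trigpolyX f n : trigpoly f -> trigpoly (fun x => f x ^+ n).
Proof.
move=> tf; elim: n => [|n IH]; first exact: trigpoly_cst.
by under eq_fun do rewrite exprS; exact: trigpolyM.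
Qed.

Lemma trigpoly_trig1 : trigpoly (trig 1).
Proof. by exists 'X, 0%N => x; rewrite expr0 mul1r hornerX. Qed.

Lemma trigpoly_trigN1 : trigpoly (fun x => (trig 1 x)^*).
Proof. by exists 1%:P, 1%N => x; rewrite expr1 hornerC mulr1. Qed.

Lemma trigpoly_cos (s : R) : trigpoly (fun x => (cos (2 * pi / L * (x - s)))%:C).
Proof.
have -> : (fun x : R => (cos (2 * pi / L * (x - s)))%:C) = (fun x =>
   (trig 1 s)^* / 2 * trig 1 x + trig 1 s / 2 * (trig 1 x)^*).
  apply/funext => x; rewrite -!trigN.
  have E (A B : R[i]) : A / 2 * B = A * B / 2 by rewrite mulrAC.
  rewrite !E -mulrDl.
  have -> : trig (-1) s * trig 1 x = expi (2 * pi / L * (x - s)).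
    by rewrite /trig -expiD; congr expi; rewrite rmorphN /=; ring.
  have -> : trig 1 s * trig (-1) x = expi (- (2 * pi / L * (x - s))).
    by rewrite /trig -expiD; congr expi; rewrite rmorphN /=; ring.
  rewrite /expi cosN sinN.
  apply: (@mulIf _ (2 : R[i])); first by rewrite pnatr_eq0.
  rewrite mulfVK ?pnatr_eq0//.
  by apply: complexP => /=; ring.
apply: trigpolyD; apply: trigpolyM.
- exact: trigpoly_cst.
- exact: trigpoly_trig1.
- exact: trigpoly_cst.
- exact: trigpoly_trigN1.
Qed.

Lemma trigpoly_span f : trigpoly f ->
  exists (s : seq int) (d : int -> R[i]),
    uniq s /\ forall x, f x = \sum_(k <- s) d k * trig k x.
Proof.
move=> [p [n pf]].
(* The factor [conj (trig 1) ^+ n] lowers all frequencies by [n]. On the listed [k] the sum [k + n]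
   is nonnegative, so [absz] returns the index of the coefficient. *)
exists [seq i%:Z - n%:Z | i <- index_iota 0 (size p)], (fun k => p`_(absz (k + n%:Z))).
split.
  by rewrite map_inj_uniq ?iota_uniq// => i j /addIr [].
move=> x; rewrite pf horner_coef mulr_sumr big_map.
rewrite big_mkord; apply: eq_bigr => i _.
rewrite subrK absz_nat mulrCA; congr (_ * _).
by rewrite trigD trigN (trig_nat i) (trig_nat n) mulrC cJX.
Qed.

Lemma L2_trigpoly f : trigpoly f -> L2 (fun x => (\1_D x)%:C * f x).
Proof.
move=> /trigpoly_span[s [d [_ fE]]].
rewrite (_ : (fun x => _) = fun x => \sum_(k <- s) d k * itrig k x).
  by apply: L2_sum => k; apply: L2Z; exact: L2_itrig.
apply/funext => x; rewrite fE mulr_sumr; apply: eq_bigr => k _.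
by rewrite /itrig mulrCA.
Qed.

End TrigPolynomials.

(** * Polynomials approximating a step function on [0, 1] *)

Section Bump.
Variable R : realType.
Implicit Types y z t : R.

(* [(1 - y ^ n) ^ (n 2 ^ n)] tends to the indicator of [y < 1/2] on [0, 1]. *)
Definition bump (n : nat) y : R := (1 - y ^+ n) ^+ (n * 2 ^ n)%N.

Lemma bernoulli_ge (m : nat) t : -1 <= t -> 1 + m%:R * t <= (1 + t) ^+ m.
Proof.
move=> t1; have t0 : 0 <= 1 + t by lra.
elim: m => [|m IH]; first by rewrite mul0r addr0 expr0.
rewrite exprS; apply: le_trans (ler_wpM2l t0 IH).
have := sqr_ge0 t; have : (0 : R) <= m%:R by [].
rewrite -[m.+1%:R]natr1; nra.
Qed.

(** Write z = r^2 and 1/r = 1 + q. By Bernoulli n q <= r^(-n), so one factor r^n absorbs [n] and the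
    other tends to 0. *)
Lemma cvg_nat_mul_expr z : 0 <= z < 1 -> n%:R * z ^+ n @[n --> \oo] --> (0 : R).
Proof.
move=> /andP[z0 z1]; have [->|zn0] := eqVneq z 0.
  rewrite (_ : (fun n => _) = cst 0); first exact: cvg_cst.
  by apply/funext => -[|n]; rewrite ?mul0r// expr0n mulr0.
have {z0} zn0 : 0 < z by rewrite lt_neqAle eq_sym zn0.
pose r := Num.sqrt z; have r0 : 0 < r by rewrite sqrtr_gt0.
have rr : r ^+ 2 = z by rewrite sqr_sqrtr// ltW.
have r1 : r < 1 by rewrite -(expr_lt1 (n := 2))// ?rr// ltW.
pose q := r^-1 - 1; have q0 : 0 < q by rewrite subr_gt0 invf_gt1.
have H n : n%:R * z ^+ n <= q^-1 * r ^+ n.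
  rewrite -rr -exprM mulnC exprM expr2 mulrA.
  apply: ler_wpM2r; first by rewrite exprn_ge0// ltW.
  have := @bernoulli_ge n q; rewrite /q.
  rewrite (_ : 1 + (r^-1 - 1) = r^-1); last by ring.
  move=> /(_ _)/wrap[|B]; first by rewrite lerBrDr addNr invr_ge0 ltW.
  rewrite -/q in B *; rewrite -ler_pdivlMr ?exprn_gt0// -exprVn ler_pdivlMl//.
  by apply: le_trans B; rewrite mulrC lerDr.
apply: (@squeeze_cvgr _ _ _ _ (cst 0) (fun n => q^-1 * r ^+ n)).
- by apply: nearW => n; rewrite H mulr_ge0// exprn_ge0// ltW.
- exact: cvg_cst.
- rewrite -[X in _ --> X](mulr0 q^-1); apply: cvgMr.
  by apply: cvg_expr; rewrite ger0_norm// ltW.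
Qed.

Lemma bump_ge0 n y : 0 <= y <= 1 -> 0 <= bump n y.
Proof.
by move=> /andP[y0 y1]; rewrite exprn_ge0// subr_ge0 exprn_ile1.
Qed.

Lemma bump_le1 n y : 0 <= y <= 1 -> bump n y <= 1.
Proof.
move=> /andP[y0 y1]; rewrite exprn_ile1// ?subr_ge0 ?exprn_ile1//.
by rewrite gerBl exprn_ge0.
Qed.

(** Bernoulli gives [bump n y >= 1 - n (2 y)^n], and here 2 y < 1. *)
Lemma bump_cvg1 y : 0 <= y -> y < 1 / 2 -> bump n y @[n --> \oo] --> (1 : R).
Proof.
move=> y0 y2; have y1 : 0 <= y <= 1 by lra.
apply: (@squeeze_cvgr _ _ _ _ (fun n => 1 - n%:R * (2 * y) ^+ n) (cst 1)).
- apply: nearW => n; rewrite bump_le1// andbT.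
  have := @bernoulli_ge (n * 2 ^ n) (- y ^+ n).
  move=> /(_ _)/wrap[|]; first by rewrite lerN2 exprn_ile1//; lra.
  by rewrite natrM natrX mulrN -mulrA -exprMn.
- rewrite -[X in _ --> X]subr0; apply: cvgB; first exact: cvg_cst.
  by apply: cvg_nat_mul_expr; lra.
- exact: cvg_cst.
Qed.

(** With v = y^n, (1 - v)(1 + v) <= 1 turns Bernoulli's lower bound for (1 + v)^K into an upper
    bound for (1 - v)^K. As 2 y >= 1, that lower bound is at least n + 1; the factor [n] in the
    exponent makes this work even at y = 1/2. *)
Lemma bump_cvg0 y : 1 / 2 <= y -> y <= 1 -> bump n y @[n --> \oo] --> (0 : R).
Proof.
move=> y2 y1; have y01 : 0 <= y <= 1 by lra.
apply: (@squeeze_cvgr _ _ _ _ (cst 0) (fun n => n.+1%:R^-1)).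
- apply: nearW => n; rewrite bump_ge0//=.
  set K := (n * 2 ^ n)%N; have yn1 : y ^+ n <= 1 by rewrite exprn_ile1//; lra.
  have yn0 : 0 <= y ^+ n by rewrite exprn_ge0//; lra.
  have B : n.+1%:R <= (1 + y ^+ n) ^+ K.
    have := @bernoulli_ge K (y ^+ n); move=> /(_ _)/wrap[|]; first by lra.
    apply: le_trans; rewrite natrM natrX -mulrA -exprMn -natr1 addrC lerD2l.
    by rewrite ler_peMr// exprn_ege1//; lra.
  have Kp : 0 < (1 + y ^+ n) ^+ K by exact: lt_le_trans B.
  rewrite -[n.+1%:R^-1]div1r ler_pdivlMr//.
  apply: (@le_trans _ _ (bump n y * (1 + y ^+ n) ^+ K)).
    by rewrite ler_wpM2l// bump_ge0.
  rewrite -exprMn exprn_ile1//; first by nra.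
  by rewrite -subr_ge0 (_ : _ - _ = (y ^+ n) ^+ 2) ?sqr_ge0//; ring.
- exact: cvg_cst.
- exact: cvg_harmonic.
Qed.

End Bump.

Section Dominated.
Variable R : realType.
Local Notation mu := (@lebesgue_measure R).

Lemma nm_dominated_cvg0 (h_ : nat -> R -> R[i]) (G : R -> R) :
  (forall n, cmeas (h_ n)) -> mu.-integrable setT (EFin \o G) ->
  (forall n x, sqn (h_ n x) <= G x) ->
  (forall x, sqn (h_ n x) @[n --> \oo] --> (0 : R)) ->
  nm (h_ n) @[n --> \oo] --> (0 : R).
Proof.
move=> mh iG hG h0.
have [| | | | |_ _] := @dominated_convergence _ _ R mu setT measurableT
  (fun n x => (sqn (h_ n x))%:E) (cst 0%E) (EFin \o G).
- by move=> n; exact: emeasurable_sqn.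
- exact: measurable_cst.
- by apply: aeW => x _; apply: cvg_EFin; [exact: nearW|exact: h0].
- exact: iG.
- by apply: aeW => x n _; rewrite /= lee_fin ger0_norm ?sqn_ge0.
- by rewrite integral0 => /fine_cvgP[_]; exact.
Qed.

End Dominated.

(** * Approximation of indicators of arcs by trigonometric polynomials *)

Section TrigDensity.
Variables (R : realType) (a L : R).
Hypothesis L0 : 0 < L.
Local Notation mu := (@lebesgue_measure R).
Implicit Types f g h : R -> R[i].
Local Notation D := `]a, (a + L)[%classic.

Definition trig_approx g := forall e : R, 0 < e -> exists2 f,
  trigpoly L f & nm (fun x => g x - (\1_D x)%:C * f x) < e.

Lemma trig_approx_lim g : L2 g ->
  (forall e, 0 < e -> exists h, [/\ L2 h, trig_approx h &
    nm (fun x => g x - h x) < e]) -> trig_approx g.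
Proof.
(* Two squared errors are added, each with factor 2, hence the share [e / 4]. *)
move=> g2 H e e0; have e4 : 0 < e / 4 by rewrite divr_gt0.
have [h [h2 /(_ _ e4)[f tf hf] gh]] := H _ e4.
exists f => //.
have f2 := L2_trigpoly a L0 tf.
have := nmD_le ltr01 (L2B g2 h2) (L2B h2 f2).
rewrite invr1; under eq_fun do rewrite addrA subrK.
move=> /le_lt_trans; apply; lra.
Qed.

Lemma trig_approx_trigpoly f : trigpoly L f ->
  trig_approx (fun x => (\1_D x)%:C * f x).
Proof.
move=> tf e e0; exists f => //; under eq_fun do rewrite subrr.
by rewrite /nm N20.
Qed.

Lemma trig_approxD g h : L2 g -> L2 h -> trig_approx g -> trig_approx h ->
  trig_approx (fun x => g x + h x).
Proof.
move=> g2 h2 Hg Hh e e0; have e4 : 0 < e / 4 by rewrite divr_gt0.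
have [f tf gf] := Hg _ e4; have [k tk hk] := Hh _ e4.
exists (fun x => f x + k x); first exact: trigpolyD.
have := nmD_le ltr01 (L2B g2 (L2_trigpoly a L0 tf)) (L2B h2 (L2_trigpoly a L0 tk)).
rewrite invr1.
rewrite (_ : (fun x => _) =
  (fun x => g x + h x - (\1_D x)%:C * (f x + k x))); last first.
  by apply/funext => x; ring.
move=> /le_lt_trans; apply; lra.
Qed.

Lemma trig_approxZ c g : L2 g -> trig_approx g -> trig_approx (fun x => c * g x).
Proof.
move=> g2 Hg e e0.
(* The [+ 1] keeps the divisor positive when [c = 0]. *)
have c0 : 0 < sqn c + 1 by rewrite ltr_wpDl// sqn_ge0.
have [|f tf gf] := Hg (e / (sqn c + 1)); first by rewrite divr_gt0.
exists (fun x => c * f x); first by apply: trigpolyM => //; exact: trigpoly_cst.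
rewrite (_ : (fun x => _) = (fun x => c * (g x - (\1_D x)%:C * f x))); last first.
  by apply/funext => x; ring.
rewrite nmZ; last by apply: L2B => //; exact: L2_trigpoly.
rewrite ltr_pdivlMr// in gf; apply: le_lt_trans gf.
by rewrite mulrC ler_wpM2l ?nm_ge0// lerDl.
Qed.

Lemma trig_approx_sum (I : Type) (s : seq I) (F : I -> R -> R[i]) :
  (forall i, L2 (F i)) -> (forall i, trig_approx (F i)) ->
  trig_approx (fun x => \sum_(i <- s) F i x).
Proof.
move=> F2 HF; elim: s => [|i s IH].
  under eq_fun do rewrite big_nil.
  have := trig_approx_trigpoly (trigpoly_cst L 0).
  by under eq_fun do rewrite mulr0.
under eq_fun do rewrite big_cons; apply: trig_approxD => //.
exact: L2_sum.
Qed.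

Lemma integrable_indicD :
  mu.-integrable setT (EFin \o (fun x => \1_D x : R)).
Proof. exact: integrable_indic_itv. Qed.

Definition cindic (A : set R) (x : R) : R[i] := (\1_(A `&` D) x)%:C.

Lemma L2_cindic A : measurable A -> L2 (cindic A).
Proof.
move=> mA; rewrite (_ : cindic A = fun x => (\1_(A `&` D) x)%:C * 1).
  apply: (@L2_indic_le _ a L L0).
  - exact: measurableI.
  - by move=> x [].
  - exact: cmeas_cst.
  - by move=> x; rewrite -[1]/(1%:C) sqn_real expr1n.
by apply/funext => x; rewrite mulr1.
Qed.

(* An interval ending at [a + L] is an arc of the circle of length [L], cut out
   by a cosine centred at the midpoint of the arc. *)
Lemma arc_cos (b x : R) : a <= b -> b < a + L -> D x ->
  let s := (b + (a + L)) / 2 in let w := (a + L - b) / 2 in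
  (cos (2 * pi / L * w) < cos (2 * pi / L * (x - s))) = (b < x).
Proof.
move=> ab bL; rewrite /= in_itv /= => /andP[ax xL].
set s := (b + _) / 2; set w := (_ - b) / 2.
have p0 : 0 < 2 * pi / L by rewrite divr_gt0// mulr_gt0// pi_gt0.
have pE : 2 * pi / L * (L / 2) = pi by field; rewrite gt_eqF.
have w0 : 0 < w by rewrite /w; lra.
have wL : w <= L / 2 by rewrite /w; lra.
have in_pi t : 0 <= t -> t <= L / 2 -> 2 * pi / L * t \in `[0, pi].
  move=> t0 tL; rewrite in_itv /=; apply/andP; split.
    by apply: mulr_ge0 => //; exact: ltW.
  by rewrite -[X in _ <= X]pE ler_pM2l.
have cmp t : 0 <= t -> t <= L / 2 ->
    (cos (2 * pi / L * w) < cos (2 * pi / L * t)) = (t < w).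
  move=> t0 tL; rewrite ltr_cos ?ltr_pM2l//; apply: in_pi => //.
  exact: ltW.
have -> : cos (2 * pi / L * (x - s)) = cos (2 * pi / L * `|x - s|).
  by rewrite -[LHS]cos_norm normrM (gtr0_norm p0).
have xs : (b < x) = (`|x - s| < w).
  rewrite ltr_norml; rewrite /s /w; apply/idP/andP => [bx|[h1 h2]]; last lra.
  by split; lra.
rewrite xs; have [h|h] := leP `|x - s| (L / 2); first by rewrite cmp.
(* Beyond half a period the reflected distance [L - |x - s|] has the same cosine and falls back into
   the range where cosine decreases. It is at least [w] since [x] lies in [D], so both sides are
   false. *)
have -> : cos (2 * pi / L * `|x - s|) = cos (2 * pi / L * (L - `|x - s|)).
  rewrite -[RHS]cosN -[RHS]cosD2pi; congr cos.
  by rewrite -mulr_natl; field; rewrite gt_eqF.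
have xsL : `|x - s| <= L - w.
  by rewrite ler_norml; apply/andP; split; rewrite /s /w; lra.
rewrite cmp; [|lra|lra].
by apply/idP/idP => ?; lra.
Qed.

(** Inside [D] a ray is an arc, on which an affine function [y] of a cosine is below 1/2. Then
    [bump n (y x)] is a trigonometric polynomial between 0 and 1 that tends pointwise to the
    indicator, and dominated convergence concludes. *)
Lemma trig_approx_ray b : trig_approx (cindic `]b, +oo[).
Proof.
(* A ray starting left of [a] meets [D] in the same set as the ray starting at [a]. *)
wlog ab : b / a <= b.
  move=> H; have [|ba] := leP a b; first exact: H.
  rewrite (_ : cindic _ = cindic `]a, +oo[); first exact: H.
  apply/funext => x; rewrite /cindic !indicE; congr ((nat_of_bool _)%:R%:C).
  apply/idP/idP; rewrite !inE /= !in_itv /= !andbT => -[h1 h2]; split => //.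
    by case/andP: h2.
  by case/andP: h2 => h2 _; exact: lt_trans h2.
have [bL|Lb] := ltP b (a + L); last first.
  rewrite (_ : cindic _ = fun x => (\1_D x)%:C * 0).
    by apply: trig_approx_trigpoly; exact: trigpoly_cst.
  apply/funext => x; rewrite /cindic mulr0 indicE memNset//= !in_itv /= !andbT.
  by move=> [h1 /andP[_ h2]]; move: (lt_trans (le_lt_trans Lb h1) h2); rewrite ltxx.
pose s := (b + (a + L)) / 2; pose w := (a + L - b) / 2.
(* The difference of cosines lies in [-2, 2] and is negative exactly when [b < x]; so [y] lies in
   [0, 1] and is below 1/2 exactly there. *)
pose y x := 1 / 2 + (cos (2 * pi / L * w) - cos (2 * pi / L * (x - s))) / 4.
have y01 x : 0 <= y x <= 1.
  have := cos_le1 (2 * pi / L * w); have := cos_geN1 (2 * pi / L * w).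
  have := cos_le1 (2 * pi / L * (x - s)); have := cos_geN1 (2 * pi / L * (x - s)).
  by rewrite /y; set u := cos _; set v := cos _ => *; apply/andP; split; lra.
pose f n x : R[i] := (bump n (y x))%:C.
have tf n : trigpoly L (f n).
  rewrite (_ : f n = fun x => (1 - (((1 / 2 + cos (2 * pi / L * w) / 4)%:C +
      (- (1 / 4))%:C * (cos (2 * pi / L * (x - s)))%:C)) ^+ n) ^+ (n * 2 ^ n)%N).
    apply: trigpolyX; under eq_fun do rewrite -mulN1r.
    apply: trigpolyD; first exact: trigpoly_cst.
    apply: trigpolyM; first exact: trigpoly_cst.
    apply: trigpolyX; apply: trigpolyD; first exact: trigpoly_cst.
    apply: trigpolyM; [exact: trigpoly_cst|exact: trigpoly_cos].
  apply/funext => x; rewrite /f /bump -rmorphM -rmorphD -[1 in RHS]/(1%:C) -rmorphXn.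
  rewrite -rmorphB -rmorphXn; congr ((1 - _ ^+ _) ^+ _)%:C.
  by rewrite /y; ring.
apply: trig_approx_lim; first exact: L2_cindic.
move=> e e0.
have H : nm (fun x => cindic `]b, +oo[ x - (\1_D x)%:C * f n x) @[n --> \oo] --> (0 : R).
  apply: (@nm_dominated_cvg0 _ _ (\1_D)).
  - move=> n; apply: cmeasB; first by apply: (L2_cindic _).1.
    by have [] := L2_trigpoly a L0 (tf n).
  - exact: integrable_indicD.
  - move=> n x; rewrite /cindic !indicE in_setI /f.
    have [xD|xD] := boolP (x \in D); last by rewrite andbF mul0r subrr sqn0.
    rewrite andbT mul1r -rmorphB sqn_real.
    have := bump_ge0 n (y01 x); have := bump_le1 n (y01 x).
    by case: (x \in _) => /= *; nra.
  - move=> x; rewrite /cindic !indicE in_setI.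
    have [xD|xD] := boolP (x \in D); last first.
      rewrite andbF (_ : (fun n => _) = cst 0); first exact: cvg_cst.
      by apply/funext => n; rewrite mul0r subrr sqn0.
    rewrite andbT; rewrite inE in xD.
    have := arc_cos ab bL xD; rewrite /= -/s -/w => arcE.
    rewrite (_ : (x \in _) = (b < x)); last first.
      by apply/idP/idP; rewrite inE /= in_itv /= andbT.
    suff : (b < x)%R%:R - bump n (y x) @[n --> \oo] --> (0 : R).
      move=> K; have := cvgM K K; rewrite mulr0.
      rewrite (_ : (fun n => sqn _) = (fun n => ((b < x)%R%:R - bump n (y x)) * ((b < x)%R%:R - bump n (y x)))).
        by apply.
      apply/funext => n; rewrite mul1r /f -rmorphB sqn_real expr2.
      by [].
    have [bx|bx] := ltP b x.
      rewrite -[X in _ --> X](subrr 1); apply: cvgB; first exact: cvg_cst.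
      apply: bump_cvg1; first by case/andP: (y01 x).
      by rewrite bx in arcE; rewrite /y; lra.
    rewrite -[X in _ --> X](subrr 0); apply: cvgB; first exact: cvg_cst.
    apply: bump_cvg0; last by case/andP: (y01 x).
    move: arcE; rewrite [b < x]ltNge bx /= => /negbT.
    by rewrite -leNgt /y => ?; lra.
move/cvgrPdist_lt : H => /(_ e e0)[n _ /(_ n (leqnn n))].
rewrite sub0r normrN ger0_norm ?nm_ge0// => H.
exists (fun x => (\1_D x)%:C * f n x); split => //.
- exact: L2_trigpoly.
- exact: trig_approx_trigpoly.
Qed.

End TrigDensity.

(** * Density of trigonometric polynomials in L2 of an interval, and Parseval's identity *)

Section Parseval.
Variables (R : realType) (a L : R).
Hypothesis L0 : 0 < L.
Local Notation mu := (@lebesgue_measure R).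
Implicit Types f g h : R -> R[i].
Local Notation D := `]a, (a + L)[%classic.
Local Notation cindic := (cindic a L).
Local Notation trig_approx := (trig_approx a L).

Lemma trig_approx_lim_seq g (h_ : nat -> R -> R[i]) (G : R -> R) : L2 g ->
  (forall n, L2 (h_ n)) -> (forall n, trig_approx (h_ n)) ->
  mu.-integrable setT (EFin \o G) ->
  (forall n x, sqn (g x - h_ n x) <= G x) ->
  (forall x, sqn (g x - h_ n x) @[n --> \oo] --> (0 : R)) ->
  trig_approx g.
Proof.
move=> g2 h2 Hh iG hG hcvg; apply: trig_approx_lim => // e e0.
have H : nm (fun x => g x - h_ n x) @[n --> \oo] --> (0 : R).
  apply: (@nm_dominated_cvg0 _ _ G) => //.
  by move=> n; apply: cmeasB; [case: g2|case: (h2 n)].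
move/cvgrPdist_lt : H => /(_ e e0)[n _ /(_ n (leqnn n))].
by rewrite sub0r normrN ger0_norm ?nm_ge0// => H; exists (h_ n).
Qed.

Lemma cindic_bigcup_partial (F : (set R)^nat) n x : trivIset setT F ->
  \sum_(k < n) cindic (F k) x = cindic (\bigcup_(k in `I_n) F k) x.
Proof.
move=> tF; rewrite /cindic indicE.
have [|nx] := boolP (x \in _); last first.
  rewrite big1// => k _; rewrite indicE memNset//= => -[Fx Dx].
  move/negP: nx; apply; rewrite inE /=; split => //.
  by exists k => //=.
rewrite inE /= => -[[k /= kn Fkx] Dx].
rewrite (bigD1 (Ordinal kn))//= indicE mem_set// big1 ?addr0// => i ik.
rewrite indicE memNset//= => -[Fix _].
move/trivIsetP : tF => /(_ i k Logic.I Logic.I).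
have ik' : i != k :> nat by apply: contra ik => /eqP ?; apply/eqP/val_inj.
by move=> /(_ ik') /seteqP[/(_ x) + _]; apply.
Qed.

(** Rays are stable under intersection and generate the Borel sets, while the sets with approximable
    indicator are closed under complement and countable disjoint union: Dynkin's theorem applies. *)
Lemma trig_approx_cindic A : measurable A -> trig_approx (cindic A).
Proof.
move=> mA.
have tT : trig_approx (cindic setT).
  rewrite (_ : cindic setT = fun x => (\1_D x)%:C * 1); last first.
    by apply/funext => x; rewrite /cindic setTI mulr1.
  by apply: trig_approx_trigpoly; exact: trigpoly_cst.
apply: (@dynkin_induction _ (measurableTypeR R) (@RGenOInfty.G R)
   (fun A => trig_approx (cindic A))) => //.
- exact: RGenOInfty.measurableE.
- move=> _ _ [x ->] [y ->]; exists (Num.max x y).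
  apply/seteqP; split => z /=; rewrite !in_itv /= !andbT gt_max.
    by move=> [-> ->].
  by move/andP.
- by move=> _ [x ->]; exact: trig_approx_ray.
- move=> S mS HS.
  rewrite (_ : cindic _ = fun x => cindic setT x + (- 1) * cindic S x).
    apply: trig_approxD => //; try exact: L2_cindic.
    - by apply: L2Z; exact: L2_cindic.
    - by apply: trig_approxZ => //; exact: L2_cindic.
  apply/funext => x; rewrite /cindic !indicE !in_setI in_setC in_setT mulN1r.
  case: (x \in S); case: (x \in D) => /=; rewrite ?subrr ?subr0//.
- move=> F mF tF HF.
  apply: (@trig_approx_lim_seq _ (fun n x => \sum_(k < n) cindic (F k) x) \1_D).
  + by apply: L2_cindic => //; exact: bigcupT_measurable.
  + by move=> n; apply: L2_sum => k; apply: L2_cindic => //; exact: mF.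
  + by move=> n; apply: trig_approx_sum => // k; apply: L2_cindic => //; exact: mF.
  + exact: integrable_indicD.
  + move=> n x; rewrite cindic_bigcup_partial// /cindic !indicE !in_setI.
    case: (x \in D); last by rewrite !andbF subrr sqn0.
    rewrite !andbT -rmorphB sqn_real.
    by case: (_ \in _); case: (_ \in _) => /=; rewrite ?subrr ?subr0 ?sub0r ?expr0n ?expr1n// sqrrN expr1n.
  + move=> x.
    have [[k _ Fkx]|nF] := pselect ((\bigcup_k F k) x); last first.
      rewrite (_ : (fun n => _) = cst 0); first exact: cvg_cst.
      apply/funext => n; rewrite cindic_bigcup_partial// /cindic !indicE !memNset ?subrr ?sqn0//=.
      * by move=> -[[k _ Fkx] _]; apply: nF; exists k.
      * by move=> -[].
    apply: (@cvg_near_cst _ _ _ _ _ _); exists k.+1 => // n /= kn.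
    rewrite cindic_bigcup_partial// /cindic !indicE.
    suff -> : (x \in (\bigcup_(k in `I_n) F k) `&` D) = (x \in (\bigcup_k F k) `&` D).
      by rewrite subrr sqn0.
    apply/idP/idP; rewrite !inE /= => -[_ Dx]; split => //; first by exists k.
    by exists k.
- have : (@RGenOInfty.G R).-sigma.-measurable A; last exact.
  by rewrite -RGenOInfty.measurableE.
Qed.

Import HBNNSimple.

Lemma trig_approx_nonneg (g : R -> R) : (forall x, 0 <= g x) ->
  L2 (fun x => (g x)%:C) -> (forall x, ~ D x -> g x = 0) ->
  trig_approx (fun x => (g x)%:C).
Proof.
move=> g0 g2 gD.
have mg : measurable_fun setT (EFin \o g).
  by apply/measurable_EFinP; case: g2 => -[].
pose f_ := nnsfun_approx measurableT mg.
have f_le n x : f_ n x <= g x.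
  by rewrite -lee_fin nnsfun_approxE; apply: (@le_approx _ _ _ _ (EFin \o g)) => // t _; rewrite lee_fin.
have f_ge0 n x : 0 <= f_ n x by [].
have f_cvg x : f_ n x @[n --> \oo] --> g x.
  have H := @cvg_nnsfun_approx _ _ _ _ measurableT _ mg _ x Logic.I.
  by have /fine_cvgP[_] := H (fun t _ => g0 t).
have fD n x : ~ D x -> f_ n x = 0.
  by move=> /gD gx; apply/eqP; rewrite eq_le f_ge0 andbT -gx f_le.
have mf n : cmeas (fun x => (f_ n x)%:C).
  by apply: cmeas_real; exact: measurable_funP.
have fE n : (fun x => (f_ n x)%:C) = fun x =>
    \sum_(y <- finmap.enum_fset (fset_set (range (f_ n)))) y%:C * cindic (f_ n @^-1` [set y]) x.
  apply/funext => x; have [Dx|Dx] := pselect (D x).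
    rewrite fimfunE fsbig_finite//= rmorph_sum /=.
    apply: eq_bigr => y _; rewrite rmorphM; congr (_ * _).
    by rewrite /cindic !indicE in_setI (mem_set Dx) andbT.
  rewrite fD// big1// => y _; rewrite /cindic indicE memNset ?mulr0//.
  by move=> [].
have mpre n y : measurable (f_ n @^-1` [set y]).
  by rewrite -[X in measurable X]setTI; exact: measurable_funP.
apply: (@trig_approx_lim_seq _ (fun n x => (f_ n x)%:C) (fun x => g x ^+ 2)) => //.
- move=> n; apply: (L2_le (mf n) g2) => x.
  by rewrite !sqn_real ler_sqr ?nnegrE.
- move=> n; rewrite fE; apply: trig_approx_sum => // y.
    by apply: L2Z; apply: L2_cindic => //; exact: mpre.
  apply: trig_approxZ => //; first by apply: L2_cindic => //; exact: mpre.
  by apply: trig_approx_cindic; exact: mpre.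
- have := L2_sqn_integrable g2; congr (integrable _ _ _).
  by apply/funext => x /=; rewrite sqn_real.
- move=> n x; rewrite -rmorphB sqn_real ler_sqr ?nnegrE ?subr_ge0//.
  by rewrite gerBl.
- move=> x; rewrite (_ : (fun n => _) = fun n => (g x - f_ n x) * (g x - f_ n x)); last first.
    by apply/funext => n; rewrite -rmorphB sqn_real expr2.
  have H : g x - f_ n x @[n --> \oo] --> (0 : R).
    by rewrite -[X in _ --> X](subrr (g x)); apply: cvgB => //; exact: cvg_cst.
  by have := cvgM H H; rewrite mulr0; apply.
Qed.

Lemma trig_approx_real (g : R -> R) :
  L2 (fun x => (g x)%:C) -> (forall x, ~ D x -> g x = 0) ->
  trig_approx (fun x => (g x)%:C).
Proof.
move=> g2 gD.
have mg : measurable_fun setT g by case: g2 => -[].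
have p2 : L2 (fun x => (g^\+ x)%:C).
  apply: (L2_le _ g2); first by apply: cmeas_real; exact: measurable_funrpos.
  move=> x; rewrite !sqn_real /funrpos -[leRHS]real_normK ?num_real//.
  by rewrite ler_sqr ?nnegrE ?le_max ?lexx ?orbT// ge_max normr_ge0 ler_norm.
have n2 : L2 (fun x => (g^\- x)%:C).
  apply: (L2_le _ g2); first by apply: cmeas_real; exact: measurable_funrneg.
  move=> x; rewrite !sqn_real /funrneg -[leRHS]real_normK ?num_real//.
  by rewrite ler_sqr ?nnegrE ?le_max ?lexx ?orbT// ge_max normr_ge0 -normrN ler_norm.
rewrite (_ : (fun x => _) = fun x => (g^\+ x)%:C + (- 1) * (g^\- x)%:C).
  apply: trig_approxD => //; first exact: L2Z.
    apply: trig_approx_nonneg => // x.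
    by move/gD; rewrite /funrpos => ->; rewrite maxxx.
  apply: trig_approxZ => //; apply: trig_approx_nonneg => // x.
  by move/gD; rewrite /funrneg => ->; rewrite oppr0 maxxx.
apply/funext => x; rewrite mulN1r -rmorphB; congr (_%:C).
by rewrite -[in LHS](funrposBneg g).
Qed.

Lemma trig_approx_L2 g : L2 g -> (forall x, ~ D x -> g x = 0) -> trig_approx g.
Proof.
move=> g2 gD; have [[m1 m2] _] := g2.
have r2 : L2 (fun x => (re_fun g x)%:C).
  apply: (L2_le _ g2); first exact: cmeas_real.
  by move=> x; rewrite sqn_real lerDl sqr_ge0.
have i2 : L2 (fun x => (im_fun g x)%:C).
  apply: (L2_le _ g2); first exact: cmeas_real.
  by move=> x; rewrite sqn_real lerDr sqr_ge0.
rewrite (_ : g = fun x => (re_fun g x)%:C + 'i%C * (im_fun g x)%:C).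
  apply: trig_approxD => //; first exact: L2Z.
    by apply: trig_approx_real => // x /gD; rewrite /re_fun => ->.
  by apply: trig_approxZ => //; apply: trig_approx_real => // x /gD; rewrite /im_fun => ->.
by apply/funext => x; rewrite -complexE.
Qed.

Lemma bessel_itrig (s : seq int) g : uniq s -> L2 g ->
  \sum_(k <- s) sqn (L2inner g (itrig a L k)) <= L * nm g.
Proof.
move=> us g2.
have := @nm_sub_lincomb _ _ L (itrig a L) (fun k => (L^-1)%:C * L2inner g (itrig a L k))
  s g L0 us (fun k => L2_itrig a L0 k) g2 (fun k l => itrig_orthogonal a L0 k l).
move=> H; rewrite [X in _ = _ + X]big1 ?addr0 in H; last first.
  move=> k _; rewrite mulrA -rmorphM mulfV ?gt_eqF// mul1r subrr sqn0.
  by rewrite mul0r.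
rewrite -mulr_suml in H; have := nm_ge0 (fun x => g x - \sum_(k <- s) (L^-1)%:C * L2inner g (itrig a L k) * itrig a L k x).
by rewrite H subr_ge0 ler_pdivrMr// mulrC.
Qed.

(** The finite form of Parseval, from which finite families of modulations are later selected. The
    frequencies are those of an approximating polynomial; replacing its coefficients by the Fourier
    coefficients of [g] can only reduce the distance. *)
Lemma parseval_itrig_fin g e : L2 g -> (forall x, ~ D x -> g x = 0) -> 0 < e ->
  exists2 s : seq int, uniq s &
    L * nm g - e < \sum_(k <- s) sqn (L2inner g (itrig a L k)).
Proof.
move=> g2 gD e0.
have [|f tf gf] := trig_approx_L2 g2 gD (e := e / L); first by rewrite divr_gt0.
have [s [d [us fE]]] := trigpoly_span tf; exists s => //.
have := @nm_sub_lincomb _ _ L (itrig a L) d s g L0 us (fun k => L2_itrig a L0 k) g2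
  (fun k l => itrig_orthogonal a L0 k l).
rewrite (_ : (fun x => _) = fun x => g x - (\1_D x)%:C * f x); last first.
  apply/funext => x; rewrite fE mulr_sumr; congr (_ - _).
  by apply: eq_bigr => k _; rewrite /itrig mulrCA.
move=> H; set S2 := (X in _ = _ + X) in H.
have S20 : 0 <= S2 by apply: sumr_ge0 => k _; rewrite divr_ge0 ?sqn_ge0// ltW.
move: H gf => ->; rewrite -mulr_suml => H.
have : (nm g - (\sum_(k <- s) sqn (L2inner g (itrig a L k))) / L) < e / L by lra.
rewrite ltrBlDr -mulrDl ltr_pdivlMr// => {}H.
by rewrite ltrBlDl mulrC.
Qed.

Lemma parseval_itrig g : L2 g -> (forall x, ~ D x -> g x = 0) ->
  (\esum_(k in [set: int]) (sqn (L2inner g (itrig a L k)))%:E = (L * nm g)%:E)%E.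
Proof.
move=> g2 gD; apply/eqP; rewrite eq_le; apply/andP; split.
  apply: ge_ereal_sup => _ [X [finX _] <-].
  rewrite fsbig_finite//= sumEFin lee_fin; apply: bessel_itrig => //.
  exact: finmap.fset_uniq.
apply/lee_addgt0Pr => e e0.
have [s us] := parseval_itrig_fin g2 gD e0.
rewrite ltrBlDr -lte_fin EFinD => /ltW/le_trans; apply.
rewrite leeD2r// esum_ge//; exists [set` s]; first by split => //; exact: finite_seq.
by rewrite -fsbig_seq// sumEFin.
Qed.

End Parseval.
(** * The Fourier transform on L2 *)

Section Tiling.
Variables (R : realType).
Local Notation mu := (@lebesgue_measure R).

(** Turns a sum over the integers into a series, which can be exchanged with the integral term by
    term. *)
Lemma int_enumeration : exists e : nat -> int, set_bij [set: nat] [set: int] e.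
Proof.
exists (fun n => if odd n then Negz n./2 else Posz n./2); split => //.
- move=> m n _ _; have := odd_double_half m; have := odd_double_half n.
  by case: (odd m) (odd n) => [] [] // en em [E]; rewrite -em -en E.
- move=> [k|k] _ /=.
    by exists k.*2 => //; rewrite odd_double doubleK.
  by exists k.*2.+1 => //; rewrite oddS odd_double /= uphalf_double.
Qed.

Lemma integral_tiling (T : R) (h : R -> \bar R) : 0 < T ->
  measurable_fun setT h -> (forall x, 0 <= h x)%E ->
  (\int[mu]_x h x =
   \int[mu]_(x in `[0%R, T[) \esum_(k in [set: int]) h (x + k%:~R * T)%R)%E.
Proof.
move=> T0 mh h0; have [e ebij] := int_enumeration.
pose F n := `[(e n)%:~R * T, ((e n)%:~R + 1) * T[%classic.
have mF n : measurable (F n) by exact: measurable_itv.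
have FT : [set: R] = \bigcup_n F n.
  apply/seteqP; split => // x _.
  have [_ _ /(_ (Num.floor (x / T)) Logic.I)[n _ en]] := ebij.
  exists n => //; rewrite /F /= in_itv /= en.
  by rewrite -ler_pdivlMr// -ltr_pdivrMr// ge_floor -intrD1 floorD1_gt.
have tF : trivIset [set: nat] F.
  apply/trivIsetP => i j _ _ ij; rewrite -subset0 => x [].
  rewrite /F /= !in_itv /= => /andP[i1 i2] /andP[j1 j2].
  have := le_lt_trans i1 j2; have := le_lt_trans j1 i2.
  rewrite !ltr_pM2r// -!intrD1 !ltr_int !ltzD1 => h1 h2.
  have eij : e i = e j by apply/eqP; rewrite eq_le h1 h2.
  have [_ einj _] := ebij.
  by move/negP: ij; apply; apply/eqP/einj; rewrite ?inE.
rewrite FT ge0_integral_bigcup//; last by rewrite -FT.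
under [RHS]eq_integral => x _.
  rewrite (@reindex_esum R nat int setT setT e _ ebij) -nneseries_esumT; last by move=> n; exact: h0.
  over.
rewrite integral_nneseries//; last first.
  move=> n; apply: measurable_funTS; apply: (measurableT_comp mh).
  by apply: measurable_funD => //; exact: measurable_cst.
apply: eq_eseriesr => n _.
rewrite -(@ge0_integral_shift R ((e n)%:~R * T))//; last exact: measurable_funTS.
congr (integral _ _ _).
apply/seteqP; split => x; rewrite /F /= !in_itv /= mulrDl mul1r.
  by rewrite lerDr addrC ltrD2l.
by rewrite lerDr [x + _]addrC ltrD2l.
Qed.

End Tiling.

(** * The integral Fourier transform, and Plancherel for bounded support *)

Section Fourier.
Variables (R : realType).
Local Notation mu := (@lebesgue_measure R).
Implicit Types f g h : R -> R[i].

Lemma cintegrable_integrable_norm g : cintegrable g ->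
  mu.-integrable setT
    (EFin \o (fun x => `|complex.Re (g x)| + `|complex.Im (g x)|)).
Proof.
move=> [g1 g2]; rewrite (_ : EFin \o _ =
  (EFin \o (Num.norm \o re_fun g)) \+ (EFin \o (Num.norm \o im_fun g)))%E; last first.
  by apply/funext => x /=; rewrite EFinD.
by apply: integrableD => //; exact: integrable_norm.
Qed.

Lemma Re_Im_le1 (z : R[i]) : sqn z <= 1 ->
  `|complex.Re z| <= 1 /\ `|complex.Im z| <= 1.
Proof.
rewrite /sqn => z1; split; rewrite -(@expr_le1 _ 2)// real_normK ?num_real//;
  apply: le_trans z1; by rewrite ?lerDl ?lerDr sqr_ge0.
Qed.

Lemma Re_Im_mul_le (z w : R[i]) : sqn w <= 1 ->
  `|complex.Re (z * w)| <= `|complex.Re z| + `|complex.Im z| /\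
  `|complex.Im (z * w)| <= `|complex.Re z| + `|complex.Im z|.
Proof.
move=> /Re_Im_le1[w1 w2]; rewrite cReM cImM; split.
  apply: le_trans (ler_normB _ _) _.
  by rewrite !normrM lerD// ler_piMr.
apply: le_trans (ler_normD _ _) _.
by rewrite !normrM lerD// ler_piMr.
Qed.

Lemma cintegrable_boundedM g h : cintegrable g -> cmeas h ->
  (forall x, sqn (h x) <= 1) -> cintegrable (fun x => g x * h x).
Proof.
move=> gi mh h1.
apply: (cintegrable_le _ (cintegrable_integrable_norm gi)).
- by apply: cmeasM => //; exact: cintegrable_meas.
- by move=> x; apply: (Re_Im_mul_le _ (h1 x)).1.
- by move=> x; apply: (Re_Im_mul_le _ (h1 x)).2.
Qed.

Lemma cmeas_fourier_kernel (xi : R) :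
  cmeas (fun x : R => expi (- (2 * pi * x * xi))).
Proof.
apply: cmeas_expi_comp; rewrite (_ : (fun x => _) = fun x => (- (2 * pi * xi)) * x).
  apply: continuous_measurable_fun; exact: mulrl_continuous.
by apply/funext => x; ring.
Qed.

Lemma cintegrable_fourier g (xi : R) : cintegrable g ->
  cintegrable (fun x => g x * expi (- (2 * pi * x * xi))).
Proof.
move=> gi; apply: cintegrable_boundedM => //; first exact: cmeas_fourier_kernel.
by move=> x; rewrite sqn_expi.
Qed.

Lemma fourierD f g (xi : R) : cintegrable f -> cintegrable g ->
  fourier (fun x => f x + g x) xi = fourier f xi + fourier g xi.
Proof.
move=> fi gi; rewrite /fourier -cintegralD; try exact: cintegrable_fourier.
by congr cintegral; apply/funext => x; rewrite mulrDl.
Qed.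

Lemma fourierZ c f (xi : R) : cintegrable f ->
  fourier (fun x => c * f x) xi = c * fourier f xi.
Proof.
move=> fi; rewrite /fourier -cintegralZ; last exact: cintegrable_fourier.
by congr cintegral; apply/funext => x; rewrite mulrA.
Qed.

Lemma fourierB f g (xi : R) : cintegrable f -> cintegrable g ->
  fourier (fun x => f x - g x) xi = fourier f xi - fourier g xi.
Proof.
move=> fi gi; under eq_fun do rewrite -mulN1r.
by rewrite fourierD ?fourierZ ?mulN1r//; exact: cintegrableZ.
Qed.

(** Continuity under the integral sign, dominated by |Re g| + |Im g|. Its purpose is the
    measurability of [fourier g]. *)
Lemma continuous_fourier g : cintegrable g ->
  continuous (re_fun (fourier g)) /\ continuous (im_fun (fourier g)).
Proof.
move=> gi.
have cker x : continuous (fun xi : R => cos (- (2 * pi * x * xi))) /\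
              continuous (fun xi : R => sin (- (2 * pi * x * xi))).
  have c1 : continuous (fun xi : R => - (2 * pi * x * xi)).
    by move=> y; apply: continuousN; exact: mulrl_continuous.
  split => y; apply: continuous_comp; try exact: c1.
    exact: continuous_cos.
  exact: continuous_sin.
split => x.
- have := @continuity_under_integral R _ (measurableTypeR R) mu
    (fun xi y => complex.Re (g y * expi (- (2 * pi * y * xi)))) setT measurableT
    (x - 1) (x + 1).
  move=> /(_ _ _ (fun y => `|complex.Re (g y)| + `|complex.Im (g y)|)) H.
  apply: H => //.
  + by move=> xi _; exact: (cintegrable_fourier xi gi).1.
  + apply: aeW => y _ xi _; under eq_fun do rewrite cReM /=.
    apply: cvgB; apply: cvgM; try exact: cvg_cst.
      exact: (cker y).1.
    exact: (cker y).2.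
  + exact: cintegrable_integrable_norm.
  + by move=> xi _; apply: aeW => y _; apply: (Re_Im_mul_le _ _).1; rewrite sqn_expi.
  + by rewrite inE /= in_itv /= ltrBlDr !ltrDl !ltr01.
- have := @continuity_under_integral R _ (measurableTypeR R) mu
    (fun xi y => complex.Im (g y * expi (- (2 * pi * y * xi)))) setT measurableT
    (x - 1) (x + 1).
  move=> /(_ _ _ (fun y => `|complex.Re (g y)| + `|complex.Im (g y)|)) H.
  apply: H => //.
  + by move=> xi _; exact: (cintegrable_fourier xi gi).2.
  + apply: aeW => y _ xi _; under eq_fun do rewrite cImM /=.
    apply: cvgD; apply: cvgM; try exact: cvg_cst.
      exact: (cker y).2.
    exact: (cker y).1.
  + exact: cintegrable_integrable_norm.
  + by move=> xi _; apply: aeW => y _; apply: (Re_Im_mul_le _ _).2; rewrite sqn_expi.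
  + by rewrite inE /= in_itv /= ltrBlDr !ltrDl !ltr01.
Qed.

Lemma cmeas_fourier g : cintegrable g -> cmeas (fourier g).
Proof.
by move=> /continuous_fourier[c1 c2]; split; exact: continuous_measurable_fun.
Qed.

(** From |b| <= 1 + b^2, the constant 1 being integrable on a bounded interval. *)
Lemma L2_cintegrable_itv (a L : R) g : L2 g ->
  (forall x, ~ `]a, (a + L)[%classic x -> g x = 0) -> cintegrable g.
Proof.
move=> g2 gD; set D := `]a, (a + L)[%classic in gD *.
have H : mu.-integrable setT (EFin \o (fun x => \1_D x + sqn (g x))).
  rewrite (_ : EFin \o _ =
    (EFin \o (fun x => \1_D x)) \+ (EFin \o (fun x => sqn (g x))))%E; last first.
    by apply/funext => x /=; rewrite EFinD.
  apply: integrableD => //; [exact: integrable_indic_itv|exact: L2_sqn_integrable].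
have bnd (b c : R) : `|b| <= 1 + (b ^+ 2 + c ^+ 2).
  have := sqr_ge0 c; have := sqr_ge0 (`|b| - 1).
  rewrite sqrrB1 real_normK ?num_real// => h1 h2.
  have := normr_ge0 b; lra.
have bnd1 (b c : R) : `|b| <= 1 + (c ^+ 2 + b ^+ 2) by rewrite [c ^+ 2 + _]addrC.
apply: (cintegrable_le _ H).
- by case: g2.
- move=> x; have [xD|xD] := pselect (D x).
    by rewrite indicE mem_set// bnd.
  by rewrite gD// normr0 addr_ge0// ?sqn_ge0// indicE.
- move=> x; have [xD|xD] := pselect (D x).
    by rewrite indicE mem_set// bnd1.
  by rewrite gD// normr0 addr_ge0// ?sqn_ge0// indicE.
Qed.

(* By periodization, [|hat g|^2] integrates to the integral over [0, 1/L[ of the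
   sums over [k] of [|hat g (xi + k/L)|^2], and these values are the Fourier
   coefficients of [g(x) e^(-2 i pi x xi)] on [a, a + L]. *)
Lemma plancherel_itv (a L : R) g : 0 < L -> L2 g ->
  (forall x, ~ `]a, (a + L)[%classic x -> g x = 0) -> N2 (fourier g) = N2 g.
Proof.
move=> L0 g2 gD; have gi := L2_cintegrable_itv g2 gD.
have mF := cmeas_fourier gi.
rewrite /N2 (@integral_tiling _ L^-1)//; last 3 first.
- by rewrite invr_gt0.
- exact: emeasurable_sqn.
- by move=> x; rewrite lee_fin sqn_ge0.
have gxi2 (xi : R) : L2 (fun x => expi (- (2 * pi * x * xi)) * g x).
  apply: L2_unimodularM => //; first exact: cmeas_fourier_kernel.
  by move=> x; rewrite sqn_expi.
under eq_integral => xi _.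
  rewrite (eq_esum (b := fun k => (sqn (L2inner (fun x => expi (- (2 * pi * x * xi)) * g x) (itrig a L k)))%:E)); last first.
    move=> k _; congr (sqn _)%:E; congr cintegral; apply/funext => x.
    have [xD|xD] := pselect (`]a, (a + L)[%classic x); last first.
      by rewrite gD// mulr0 !mul0r.
    rewrite /itrig indicE mem_set// mul1r /trig -expiN [RHS]mulrC mulrA -expiD [LHS]mulrC.
    by congr (expi _ * _); field; rewrite gt_eqF.
  rewrite (parseval_itrig L0 (gxi2 xi)); last first.
    by move=> x xD; rewrite gD// mulr0.
  rewrite nm_unimodularM; last by move=> x; rewrite sqn_expi.
  over.
rewrite integral_cst//= lebesgue_measure_itv /= lte_fin invr_gt0 L0.
by rewrite -EFinB subr0 -EFinM mulrAC mulfV ?gt_eqF// mul1r -L2_fin.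
Qed.

End Fourier.

(** * Plancherel on L1 and L2, and the multiplication formula *)

Section Plancherel.
Variables (R : realType).
Local Notation mu := (@lebesgue_measure R).
Implicit Types f g h : R -> R[i].

Lemma limn_einf_le_ub (u : (\bar R)^nat) c : (forall n, u n <= c)%E ->
  (limn_einf u <= c)%E.
Proof.
move=> uc; rewrite limn_einf_lim; apply: lime_le; first exact: is_cvg_einfs.
apply: nearW => n; apply: le_trans (uc n).
by apply: ereal_inf_lbound; exists n => /=.
Qed.

(** The interval (-(n + 1), n + 1), written as []a, (a + L)[] so that the results on Fourier series
    apply literally. *)
Definition window (n : nat) : set R :=
  `](- n.+1%:R), (- n.+1%:R + 2 * n.+1%:R)[%classic.

Definition truncate (n : nat) g (x : R) : R[i] := (\1_(window n) x)%:C * g x.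

Lemma windowP n x : window n x <-> `|x| < n.+1%:R.
Proof.
rewrite /window /= in_itv /= ltr_norml.
by rewrite (_ : - _ + 2 * _ = n.+1%:R); last ring.
Qed.

Lemma near_window x : \forall n \near \oo, window n x.
Proof.
exists (Num.truncn `|x|) => // n /= xn; apply/windowP.
by apply: (lt_le_trans (truncnS_gt _)); rewrite ler_nat.
Qed.

Lemma near_truncate g x : \forall n \near \oo, truncate n g x = g x.
Proof.
near=> n; rewrite /truncate indicE mem_set ?mul1r//.
by near: n; exact: near_window.
Unshelve. all: by end_near. Qed.

Lemma sqn_truncate n g x : sqn (truncate n g x) <= sqn (g x).
Proof.
rewrite /truncate sqnM sqn_indic indicE.
by case: (_ \in _); rewrite ?mul1r ?mul0r ?sqn_ge0.
Qed.

Lemma sqn_truncateB n g x : sqn (g x - truncate n g x) <= sqn (g x).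
Proof.
rewrite /truncate indicE.
by case: (_ \in _); rewrite ?mul1r ?mul0r ?subr0// subrr sqn0 sqn_ge0.
Qed.

Lemma truncate_eq0 n g x : ~ window n x -> truncate n g x = 0.
Proof. by move=> nx; rewrite /truncate indicE memNset ?mul0r. Qed.

Lemma cmeas_truncate n g : cmeas g -> cmeas (truncate n g).
Proof.
by move=> mg; apply: cmeasM => //; apply: cmeas_indic; exact: measurable_itv.
Qed.

Lemma L2_truncate n g : L2 g -> L2 (truncate n g).
Proof.
move=> g2; apply: (L2_le _ g2); last exact: sqn_truncate.
by apply: cmeas_truncate; case: g2.
Qed.

Lemma cintegrable_truncate n g : L2 g -> cintegrable (truncate n g).
Proof.
move=> g2; apply: (L2_cintegrable_itv (L2_truncate n g2)) => x.
exact: truncate_eq0.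
Qed.

Lemma nm_truncate_cvg g : L2 g ->
  nm (fun x => truncate n g x - g x) @[n --> \oo] --> (0 : R).
Proof.
move=> g2; under eq_fun do rewrite nmBC.
apply: (@nm_dominated_cvg0 _ _ (fun x => sqn (g x))).
- by move=> n; apply: cmeasB; [case: g2|apply: cmeas_truncate; case: g2].
- exact: L2_sqn_integrable.
- by move=> n x; exact: sqn_truncateB.
- move=> x; apply: cvg_near_cst; near=> n.
  rewrite (_ : truncate n g x = g x) ?subrr ?sqn0//.
  by near: n; exact: near_truncate.
Unshelve. all: by end_near. Qed.

Lemma plancherel_truncate n g : L2 g ->
  N2 (fourier (truncate n g)) = N2 (truncate n g).
Proof.
move=> g2; apply: (@plancherel_itv _ (- n.+1%:R) (2 * n.+1%:R)).
- by rewrite mulr_gt0.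
- exact: L2_truncate.
- by move=> x; exact: truncate_eq0.
Qed.

Lemma Rintegral_dominated_cvg (f_ : nat -> R -> R) (f G : R -> R) :
  (forall n, measurable_fun setT (f_ n)) -> measurable_fun setT f ->
  mu.-integrable setT (EFin \o G) ->
  (forall n x, `|f_ n x| <= G x) ->
  (forall x, \forall n \near \oo, f_ n x = f x) ->
  \int[mu]_x f_ n x @[n --> \oo] --> \int[mu]_x f x.
Proof.
move=> mf_ mf iG fG fcvg.
have [| | | | |fi _] := @dominated_convergence _ _ R mu setT measurableT
  (fun n => EFin \o f_ n) (EFin \o f) (EFin \o G).
- by move=> n; apply/measurable_EFinP; exact: mf_.
- by apply/measurable_EFinP; exact: mf.
- apply: aeW => x _; apply: cvg_near_cst; near=> n.
  by congr EFin; near: n; exact: fcvg.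
- exact: iG.
- by apply: aeW => x n _; rewrite /= lee_fin.
- move=> H; apply: fine_cvg; rewrite fineK//; exact: integrable_fin_num.
Unshelve. all: by end_near. Qed.

Lemma fourier_truncate_cvg g (xi : R) : cintegrable g ->
  sqn (fourier (truncate n g) xi) @[n --> \oo] --> sqn (fourier g xi).
Proof.
move=> gi; have iG := cintegrable_integrable_norm gi.
have mg := cintegrable_meas gi.
have mK h : cmeas h -> cmeas (fun x : R => h x * expi (- (2 * pi * x * xi))).
  by move=> mh; apply: cmeasM => //; exact: cmeas_fourier_kernel.
have tle n x : `|complex.Re (truncate n g x)| + `|complex.Im (truncate n g x)| <=
    `|complex.Re (g x)| + `|complex.Im (g x)|.
  rewrite /truncate indicE; case: (_ \in _); rewrite ?mul1r// mul0r normr0 addr0.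
  by rewrite addr_ge0.
have nearE x : \forall n \near \oo, truncate n g x * expi (- (2 * pi * x * xi)) =
    g x * expi (- (2 * pi * x * xi)).
  by near=> n; congr (_ * _); near: n; exact: near_truncate.
have e1 (x : R) : sqn (expi (- (2 * pi * x * xi))) <= 1 by rewrite sqn_expi.
have H1 : complex.Re (fourier (truncate n g) xi) @[n --> \oo] -->
    complex.Re (fourier g xi).
  apply: (Rintegral_dominated_cvg _ _ iG).
  - by move=> n; exact: (mK _ (cmeas_truncate n mg)).1.
  - exact: (mK _ mg).1.
  - by move=> n x; apply: le_trans (Re_Im_mul_le _ (e1 x)).1 (tle n x).
  - by move=> x; near=> n; congr (complex.Re _); near: n; exact: nearE.
have H2 : complex.Im (fourier (truncate n g) xi) @[n --> \oo] -->
    complex.Im (fourier g xi).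
  apply: (Rintegral_dominated_cvg _ _ iG).
  - by move=> n; exact: (mK _ (cmeas_truncate n mg)).2.
  - exact: (mK _ mg).2.
  - by move=> n x; apply: le_trans (Re_Im_mul_le _ (e1 x)).2 (tle n x).
  - by move=> x; near=> n; congr (complex.Im _); near: n; exact: nearE.
by rewrite /sqn; apply: cvgD; exact: cvgM.
Unshelve. all: by end_near. Qed.

(** Fatou's lemma along the truncations of [g], for which equality is known. This inequality comes
    first because it puts [fourier g] in L2, where a limit argument then yields equality. *)
Lemma N2_fourier_le g : cintegrable g -> L2 g -> (N2 (fourier g) <= N2 g)%E.
Proof.
move=> gi g2.
have ti n : cintegrable (truncate n g) by exact: cintegrable_truncate.
have := @fatou _ _ R mu setT measurableT (fun n x => (sqn (fourier (truncate n g) x))%:E)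
  (fun n => emeasurable_sqn (cmeas_fourier (ti n))).
move=> /(_ _)/wrap[|H]; first by move=> n x _; rewrite lee_fin sqn_ge0.
apply: (@le_trans _ _ (\int[mu]_x limn_einf (fun n => (sqn (fourier (truncate n g) x))%:E))%E).
  rewrite le_eqVlt; apply/orP; left; apply/eqP; apply: eq_integral => x _.
  have c : (sqn (fourier (truncate n g) x))%:E @[n --> \oo] --> (sqn (fourier g x))%:E.
    by apply: cvg_EFin; [exact: nearW|exact: fourier_truncate_cvg].
  rewrite is_cvg_limn_einfE; last by apply/cvg_ex; exists (sqn (fourier g x))%:E.
  by apply/esym/cvg_lim.
apply: le_trans H _; apply: limn_einf_le_ub => n.
rewrite -/(N2 _) plancherel_truncate//; apply: le_N2.
- by apply: cmeas_truncate; case: g2.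
- by case: g2.
- exact: sqn_truncate.
Qed.

Lemma L2_fourier g : cintegrable g -> L2 g -> L2 (fourier g).
Proof.
move=> gi g2; split; first exact: cmeas_fourier.
by apply: le_lt_trans (N2_fourier_le gi g2) _; case: g2.
Qed.

Lemma nm_fourier_le g : cintegrable g -> L2 g -> nm (fourier g) <= nm g.
Proof.
move=> gi g2; rewrite -lee_fin -!L2_fin//; first exact: N2_fourier_le.
exact: L2_fourier.
Qed.

Lemma plancherel g : cintegrable g -> L2 g -> nm (fourier g) = nm g.
Proof.
move=> gi g2; apply/esym.
have tg2 n := L2_truncate n g2; have tgi n := cintegrable_truncate n g2.
apply: (@nm_cvg_eq _ (fun n => truncate n g) (fun n => fourier (truncate n g))) => //.
- by move=> n; exact: L2_fourier.
- exact: L2_fourier.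
- exact: nm_truncate_cvg.
(* By linearity the inequality applies to the differences [truncate n g - g], so the transforms
   converge in L2 as well. *)
- apply: (@squeeze_cvgr _ _ _ _ (cst 0) (fun n => nm (fun x => truncate n g x - g x))).
  + apply: nearW => n; rewrite nm_ge0/=.
    rewrite (_ : (fun x => _) = fourier (fun x => truncate n g x - g x)).
      apply: nm_fourier_le; last exact: L2B.
      under eq_fun do rewrite -mulN1r; apply: cintegrableD => //.
      exact: cintegrableZ.
    by apply/funext => x; rewrite fourierB.
  + exact: cvg_cst.
  + exact: nm_truncate_cvg.
- by move=> n; rewrite /nm plancherel_truncate.
Qed.

Lemma integrable_tensor (A B : R -> R) :
  mu.-integrable setT (EFin \o A) -> mu.-integrable setT (EFin \o B) ->
  (mu \x mu)%E.-integrable setT (fun z : R * R => (A z.1 * B z.2)%:E).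
Proof.
move=> Ai Bi.
have mA : measurable_fun setT A by apply/measurable_EFinP; exact: measurable_int Ai.
have mB : measurable_fun setT B by apply/measurable_EFinP; exact: measurable_int Bi.
apply/integrable12ltyP.
  apply/measurable_EFinP; apply: measurable_funM.
    exact: (measurableT_comp mA).
  exact: (measurableT_comp mB).
have IB : (\int[mu]_y `|(B y)%:E| < +oo)%E by case/integrableP: Bi.
have IA : (\int[mu]_y `|(A y)%:E| < +oo)%E by case/integrableP: Ai.
have mB' : measurable_fun setT (fun y => (`|B y|)%:E).
  by apply/measurable_EFinP; apply: measurableT_comp.
have mA' : measurable_fun setT (fun y => (`|A y|)%:E).
  by apply/measurable_EFinP; apply: measurableT_comp.
under eq_integral => x _.
  under eq_integral => y _ do rewrite /= normrM EFinM.
  rewrite ge0_integralZl//.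
  over.
rewrite ge0_integralZr//; last exact: integral_ge0.
by rewrite lte_mul_pinfty ?integral_ge0// ge0_fin_numE ?integral_ge0.
Qed.

Lemma Rintegral_Fubini (K : R * R -> R) : (mu \x mu)%E.-integrable setT (EFin \o K) ->
  (forall x, mu.-integrable setT (fun y => (K (x, y))%:E)) ->
  (forall y, mu.-integrable setT (fun x => (K (x, y))%:E)) ->
  \int[mu]_x \int[mu]_y K (x, y) = \int[mu]_y \int[mu]_x K (x, y).
Proof.
move=> Ki K1 K2; have := @Fubini _ _ _ _ R mu mu (EFin \o K) Ki.
move=> /(congr1 fine) H; rewrite /Rintegral.
transitivity (fine (\int[mu]_x \int[mu]_y (EFin \o K) (x, y))%E).
  congr fine; apply: eq_integral => x _; rewrite fineK//.
  exact: integrable_fin_num.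
rewrite H; congr fine; apply: eq_integral => y _; rewrite fineK//.
exact: integrable_fin_num.
Qed.

Lemma measurable_fourier_kernel2 :
  measurable_fun setT (fun z : R * R => cos (- (2 * pi * z.1 * z.2))) /\
  measurable_fun setT (fun z : R * R => sin (- (2 * pi * z.1 * z.2))).
Proof.
have H : measurable_fun setT (fun z : R * R => - (2 * pi * z.1 * z.2)).
  apply: measurableT_comp => //; apply: measurable_funM => //.
  by apply: measurable_funM => //; exact: measurable_cst.
split; apply: measurableT_comp => //; apply: continuous_measurable_fun.
  exact: continuous_cos.
exact: continuous_sin.
Qed.

(** Both sides are iterated integrals of the same kernel [K], dominated by a product of integrable
    functions. This formula plays the part of Fourier inversion in [exists_L2fourier]. *)
Lemma fourier_multiplication g h : cintegrable g -> cintegrable h ->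
  cintegral (fun xi => fourier g xi * h xi) =
  cintegral (fun x => g x * fourier h x).
Proof.
move=> gi hi.
pose K (z : R * R) := g z.1 * h z.2 * expi (- (2 * pi * z.1 * z.2)).
have Gi := cintegrable_integrable_norm gi.
have Hi := cintegrable_integrable_norm hi.
have AB := integrable_tensor Gi Hi.
have [mg1 mg2] := cintegrable_meas gi; have [mh1 mh2] := cintegrable_meas hi.
have [mc ms] := measurable_fourier_kernel2.
have mgh1 : measurable_fun setT (fun z : R * R => complex.Re (g z.1 * h z.2)).
  under eq_fun do rewrite cReM; apply: measurable_funB; apply: measurable_funM.
  - exact: (measurableT_comp mg1).
  - exact: (measurableT_comp mh1).
  - exact: (measurableT_comp mg2).
  - exact: (measurableT_comp mh2).
have mgh2 : measurable_fun setT (fun z : R * R => complex.Im (g z.1 * h z.2)).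
  under eq_fun do rewrite cImM; apply: measurable_funD; apply: measurable_funM.
  - exact: (measurableT_comp mg1).
  - exact: (measurableT_comp mh2).
  - exact: (measurableT_comp mg2).
  - exact: (measurableT_comp mh1).
have mK1 : measurable_fun setT (fun z => complex.Re (K z)).
  by rewrite /K; under eq_fun do rewrite cReM /=; apply: measurable_funB; exact: measurable_funM.
have mK2 : measurable_fun setT (fun z => complex.Im (K z)).
  by rewrite /K; under eq_fun do rewrite cImM /=; apply: measurable_funD; exact: measurable_funM.
have bnd (u v w : R[i]) : sqn w <= 1 ->
    `|complex.Re (u * v * w)| <= (`|complex.Re u| + `|complex.Im u|) * (`|complex.Re v| + `|complex.Im v|) /\
    `|complex.Im (u * v * w)| <= (`|complex.Re u| + `|complex.Im u|) * (`|complex.Re v| + `|complex.Im v|).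
  move=> w1; rewrite -mulrA.
  have [v1 v2] := Re_Im_le1 w1.
  have vE : `|complex.Re (u * (v * w))| <= `|complex.Re u| * `|complex.Re (v * w)| + `|complex.Im u| * `|complex.Im (v * w)|.
    by rewrite cReM; apply: le_trans (ler_normB _ _) _; rewrite !normrM.
  have vE' : `|complex.Im (u * (v * w))| <= `|complex.Re u| * `|complex.Im (v * w)| + `|complex.Im u| * `|complex.Re (v * w)|.
    by rewrite cImM; apply: le_trans (ler_normD _ _) _; rewrite !normrM.
  have [b1 b2] := Re_Im_mul_le v w1.
  by split; [apply: le_trans vE _|apply: le_trans vE' _]; rewrite mulrDl lerD// ler_wpM2l.
have eK (z : R * R) : sqn (expi (- (2 * pi * z.1 * z.2))) <= 1 by rewrite sqn_expi.
have iK1 : (mu \x mu)%E.-integrable setT (EFin \o (fun z => complex.Re (K z))).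
  apply: (le_integrable _ _ _ AB) => //; first exact/measurable_EFinP.
  move=> z _; rewrite /= lee_fin; apply: le_trans (bnd _ _ _ (eK z)).1 _.
  exact: ler_norm.
have iK2 : (mu \x mu)%E.-integrable setT (EFin \o (fun z => complex.Im (K z))).
  apply: (le_integrable _ _ _ AB) => //; first exact/measurable_EFinP.
  move=> z _; rewrite /= lee_fin; apply: le_trans (bnd _ _ _ (eK z)).2 _.
  exact: ler_norm.
have E1 (xi : R) : fourier g xi * h xi = cintegral (fun x => K (x, xi)).
  rewrite /fourier mulrC -cintegralZ; last exact: cintegrable_fourier.
  by congr cintegral; apply/funext => x; rewrite /K /= mulrA [h xi * _]mulrC.
have E2 (x : R) : g x * fourier h x = cintegral (fun xi => K (x, xi)).
  rewrite /fourier -cintegralZ; last exact: cintegrable_fourier.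
  congr cintegral; apply/funext => xi; rewrite /K /= mulrA; congr (_ * expi _).
  ring.
have iX (x : R) : cintegrable (fun xi => K (x, xi)).
  rewrite (_ : (fun _ => _) = fun xi => g x * (h xi * expi (- (2 * pi * xi * x)))).
    by apply: cintegrableZ; exact: cintegrable_fourier.
  by apply/funext => xi; rewrite /K /= mulrA; congr (_ * expi _); ring.
have iY (xi : R) : cintegrable (fun x => K (x, xi)).
  rewrite (_ : (fun _ => _) = fun x => h xi * (g x * expi (- (2 * pi * x * xi)))).
    by apply: cintegrableZ; exact: cintegrable_fourier.
  by apply/funext => x; rewrite /K /= mulrA [h xi * _]mulrC.
under eq_fun do rewrite E1; under [in RHS]eq_fun do rewrite E2.
apply: complexP.
  apply/esym; apply: (Rintegral_Fubini iK1) => x; first exact: (iX x).1.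
  exact: (iY x).1.
apply/esym; apply: (Rintegral_Fubini iK2) => x; first exact: (iX x).2.
exact: (iY x).2.
Qed.

End Plancherel.

(** * The relation [is_L2fourier]: linearity, translation, isometry, surjectivity on bounded
    support *)

Section L2Fourier.
Variables (R : realType).
Local Notation mu := (@lebesgue_measure R).
Implicit Types f g h F G : R -> R[i].

Lemma is_L2fourierP f F : is_L2fourier f F <->
  [/\ L2 f, L2 F & exists g_ : nat -> R -> R[i],
    [/\ forall n, cintegrable (g_ n) /\ L2 (g_ n),
      nm (fun x => g_ n x - f x) @[n --> \oo] --> (0 : R) &
      nm (fun x => fourier (g_ n) x - F x) @[n --> \oo] --> (0 : R)]].
Proof.
split.
- move=> [/inLp2P f2 /inLp2P F2 [g_ [gn c1 c2]]]; split => //; exists g_.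
  have gn' n : cintegrable (g_ n) /\ L2 (g_ n).
    by have [/inLp1P ? /inLp2P ?] := gn n.
  split => //.
  + by apply/(L2dist_cvg0 _).1 : c1 => n; apply: L2B => //; case: (gn' n).
  + apply/(L2dist_cvg0 _).1 : c2 => n; apply: L2B => //.
    by have [? ?] := gn' n; exact: L2_fourier.
- move=> [f2 F2 [g_ [gn c1 c2]]]; split; [exact/inLp2P|exact/inLp2P|].
  exists g_; split.
  + by move=> n; have [? ?] := gn n; split; [exact/inLp1P|exact/inLp2P].
  + by apply/(L2dist_cvg0 _).2 : c1 => n; apply: L2B => //; case: (gn n).
  + apply/(L2dist_cvg0 _).2 : c2 => n; apply: L2B => //.
    by have [? ?] := gn n; exact: L2_fourier.
Qed.

Lemma is_L2fourier_L2 f F : is_L2fourier f F -> L2 f /\ L2 F.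
Proof. by move=> /is_L2fourierP[]. Qed.

Lemma is_L2fourier_nm f F : is_L2fourier f F -> nm f = nm F.
Proof.
move=> /is_L2fourierP[f2 F2 [g_ [gn c1 c2]]].
apply: (nm_cvg_eq _ _ f2 F2 c1 c2) => n; have [gi g2] := gn n => //.
- exact: L2_fourier.
- by rewrite plancherel.
Qed.

Lemma is_L2fourier_fourier g : cintegrable g -> L2 g -> is_L2fourier g (fourier g).
Proof.
move=> gi g2; apply/is_L2fourierP; split => //; first exact: L2_fourier.
have z (k : R -> R[i]) : nm (fun x => k x - k x) = 0.
  by under eq_fun do rewrite subrr; rewrite /nm N20.
by exists (fun=> g); split => //; under eq_fun do rewrite z; exact: cvg_cst.
Qed.

Lemma nm_cvg0D (u_ v_ : nat -> R -> R[i]) :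
  (forall n, L2 (u_ n)) -> (forall n, L2 (v_ n)) ->
  nm (u_ n) @[n --> \oo] --> (0 : R) -> nm (v_ n) @[n --> \oo] --> (0 : R) ->
  nm (fun x => u_ n x + v_ n x) @[n --> \oo] --> (0 : R).
Proof.
move=> u2 v2 cu cv.
apply: (@squeeze_cvgr _ _ _ _ (cst 0) (fun n => 2 * nm (u_ n) + 2 * nm (v_ n))).
- apply: nearW => n; rewrite nm_ge0 /=.
  by have := nmD_le ltr01 (u2 n) (v2 n); rewrite invr1.
- exact: cvg_cst.
- rewrite -[X in _ --> X](addr0 0) -[in X in _ --> X](mulr0 2).
  by apply: cvgD; apply: cvgMr.
Qed.

Lemma is_L2fourierD f g F G : is_L2fourier f F -> is_L2fourier g G ->
  is_L2fourier (fun x => f x + g x) (fun x => F x + G x).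
Proof.
move=> /is_L2fourierP[f2 F2 [f_ [fn c1 c2]]] /is_L2fourierP[g2 G2 [g_ [gn d1 d2]]].
apply/is_L2fourierP; split; [exact: L2D|exact: L2D|].
exists (fun n x => f_ n x + g_ n x); split.
- move=> n; have [? ?] := fn n; have [? ?] := gn n.
  by split; [exact: cintegrableD|exact: L2D].
- have -> : (fun n => nm (fun x => f_ n x + g_ n x - (f x + g x))) =
     (fun n => nm (fun x => (f_ n x - f x) + (g_ n x - g x))).
    by apply/funext => n; congr nm; apply/funext => x; ring.
  by apply: nm_cvg0D => // n; apply: L2B => //; [case: (fn n)|case: (gn n)].
- have -> : (fun n => nm (fun x => fourier (fun y => f_ n y + g_ n y) x - (F x + G x))) =
     (fun n => nm (fun x => (fourier (f_ n) x - F x) + (fourier (g_ n) x - G x))).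
    apply/funext => n; congr nm; apply/funext => x.
    have [? _] := fn n; have [? _] := gn n.
    by rewrite fourierD//; ring.
  by apply: nm_cvg0D => // n; apply: L2B => //;
    [have [? ?] := fn n|have [? ?] := gn n]; exact: L2_fourier.
Qed.

Lemma is_L2fourierZ c f F : is_L2fourier f F ->
  is_L2fourier (fun x => c * f x) (fun x => c * F x).
Proof.
move=> /is_L2fourierP[f2 F2 [f_ [fn c1 c2]]].
apply/is_L2fourierP; split; [exact: L2Z|exact: L2Z|].
exists (fun n x => c * f_ n x); split.
- move=> n; have [? ?] := fn n.
  by split; [exact: cintegrableZ|exact: L2Z].
- have -> : (fun n => nm (fun x => c * f_ n x - c * f x)) =
     (fun n => sqn c * nm (fun x => f_ n x - f x)).
    apply/funext => n; rewrite -nmZ; last by apply: L2B => //; case: (fn n).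
    by congr nm; apply/funext => x; ring.
  by rewrite -[X in _ --> X](mulr0 (sqn c)); exact: cvgMr.
- have -> : (fun n => nm (fun x => fourier (fun y => c * f_ n y) x - c * F x)) =
     (fun n => sqn c * nm (fun x => fourier (f_ n) x - F x)).
    apply/funext => n; have [? ?] := fn n; rewrite -nmZ.
      by congr nm; apply/funext => x; rewrite fourierZ//; ring.
    by apply: L2B => //; exact: L2_fourier.
  by rewrite -[X in _ --> X](mulr0 (sqn c)); exact: cvgMr.
Qed.

Lemma is_L2fourier_sum (I : Type) (s : seq I) (f F : I -> R -> R[i]) :
  (forall i, is_L2fourier (f i) (F i)) ->
  is_L2fourier (fun x => \sum_(i <- s) f i x) (fun x => \sum_(i <- s) F i x).
Proof.
move=> H; elim: s => [|i s IH].
  rewrite (_ : (fun x => \sum_(i <- [::]) F i x) = fourier (fun=> 0)).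
    under eq_fun do rewrite big_nil.
    by apply: is_L2fourier_fourier; [exact: cintegrable0|exact: L20].
  apply/funext => x; rewrite big_nil /fourier.
  by under eq_fun do rewrite mul0r; rewrite cintegral0.
under eq_fun do rewrite big_cons.
under [X in is_L2fourier _ X]eq_fun do rewrite big_cons.
exact: is_L2fourierD.
Qed.

Lemma is_L2fourier_translate (k : int) f F : is_L2fourier f F ->
  is_L2fourier (translate k f) (fun x => expi (- (2 * pi * k%:~R * x)) * F x).
Proof.
move=> /is_L2fourierP[f2 F2 [f_ [fn c1 c2]]].
have me : cmeas (fun x : R => expi (- (2 * pi * k%:~R * x))).
  apply: cmeas_expi_comp; rewrite (_ : (fun x => _) = fun x => (- (2 * pi * k%:~R)) * x).
    by apply: continuous_measurable_fun; exact: mulrl_continuous.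
  by apply/funext => x; ring.
have e1 (x : R) : sqn (expi (- (2 * pi * k%:~R * x))) = 1 by rewrite sqn_expi.
apply/is_L2fourierP; split.
- exact: L2_shift.
- exact: L2_unimodularM.
exists (fun n => translate k (f_ n)); split.
- move=> n; have [? ?] := fn n.
  by split; [exact: cintegrable_shift|exact: L2_shift].
- have -> : (fun n => nm (fun x => translate k (f_ n) x - translate k f x)) =
     (fun n => nm (fun x => f_ n x - f x)); last by [].
  apply/funext => n; rewrite /nm.
  rewrite -(@N2_shift _ (- k%:~R) (fun x => f_ n x - f x))//.
  by apply: cmeasB; [case: (fn n) => _ []|case: f2].
- have -> : (fun n => nm (fun x => fourier (translate k (f_ n)) x -
        expi (- (2 * pi * k%:~R * x)) * F x)) =
     (fun n => nm (fun x => fourier (f_ n) x - F x)); last by [].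
  apply/funext => n; rewrite -[RHS](nm_unimodularM _ e1); congr nm.
  apply/funext => x; rewrite mulrBr; congr (_ - _).
  have [fi _] := fn n.
  rewrite /fourier -cintegralZ; last exact: cintegrable_fourier.
  rewrite -[RHS](@cintegral_shift _ (- k%:~R)); last first.
    by apply: cmeasZ; apply: cintegrable_meas; exact: cintegrable_fourier.
  congr cintegral; apply/funext => y; rewrite /translate mulrCA -expiD.
  by congr (_ * expi _); ring.
Qed.

Lemma is_L2fourier_inner f g F G : is_L2fourier f F -> is_L2fourier g G ->
  L2inner f g = L2inner F G.
Proof.
move=> fF gG; have [f2 F2] := is_L2fourier_L2 fF.
have [g2 G2] := is_L2fourier_L2 gG.
apply: polarization => //; try exact: is_L2fourier_nm.
by move=> a; apply: is_L2fourier_nm; apply: is_L2fourierD => //; exact: is_L2fourierZ.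
Qed.

(* The inverse transform [f] of a compactly supported [F] satisfies
   [<hat g, F> = <g, f>]; for the truncations [g] of [f] this gives
   [|hat g - F|^2 = |F|^2 - |g|^2], which tends to [|F|^2 - |f|^2 = 0]. *)
Lemma exists_L2fourier (a L : R) F : 0 < L -> L2 F ->
  (forall x, ~ `]a, (a + L)[%classic x -> F x = 0) ->
  exists f, is_L2fourier f F.
Proof.
move=> L0 F2 FD.
pose FJ x := (F x)^*.
have FJ2 : L2 FJ.
  apply: (L2_le _ F2); first by apply: cmeasJ; case: F2.
  by move=> x; rewrite sqnJ.
have FJD x : ~ `]a, (a + L)[%classic x -> FJ x = 0.
  by move=> /FD Fx; rewrite /FJ Fx; exact: rmorph0.
have FJi := L2_cintegrable_itv FJ2 FJD.
have H2 := L2_fourier FJi FJ2.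
(* Conjugating before and after the transform changes the sign in the exponent, so [f] is the
   inverse transform of [F]. *)
pose f x := (fourier FJ x)^*.
have f2 : L2 f.
  apply: (L2_le _ H2); first by apply: cmeasJ; case: H2.
  by move=> x; rewrite sqnJ.
have nf : nm f = nm F.
  have -> : nm f = nm (fourier FJ).
    by congr fine; apply: eq_integral => x _; rewrite sqnJ.
  rewrite plancherel//; congr fine; apply: eq_integral => x _.
  by rewrite sqnJ.
exists f; apply/is_L2fourierP; split => //.
exists (fun n => truncate n f); split.
- by move=> n; split; [exact: cintegrable_truncate|exact: L2_truncate].
- exact: nm_truncate_cvg.
have -> : (fun n => nm (fun x => fourier (truncate n f) x - F x)) =
    (fun n => nm f - nm (truncate n f)).
  apply/funext => n; have t2 := L2_truncate n f2.
  have ti := cintegrable_truncate n f2.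
  rewrite (nmB (L2_fourier ti t2) F2).
  have -> : L2inner (fourier (truncate n f)) F = (nm (truncate n f))%:C.
    rewrite -L2inner_self /L2inner -/(FJ _).
    rewrite (fourier_multiplication ti FJi); congr cintegral.
    apply/funext => x; rewrite -[fourier FJ x]conjCK -/(f x) /truncate.
    rewrite cJM conj_realC indicE.
    by case: (_ \in _); rewrite ?mul1r ?mul0r.
  rewrite (plancherel ti t2) nf /=; ring.
rewrite -[X in _ --> X](subrr (nm f)); apply: cvgB; first exact: cvg_cst.
by apply: nm_cvg => //; [move=> n; exact: L2_truncate|exact: nm_truncate_cvg].
Qed.

End L2Fourier.
(** * Translates and fibers *)

Section FiniteTiling.
Variable R : realType.
Local Notation mu := (@lebesgue_measure R).
Implicit Types f g h : R -> R[i].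

(** Listed so that each induction step adds the pair [M], [- M], matching the columns of the unitary
    blocks. *)
Fixpoint zball (M : nat) : seq int :=
  if M is M'.+1 then [:: M%:Z, - M%:Z & zball M'] else [:: 0].

Lemma mem_zball M m : (m \in zball M) = (absz m <= M)%N.
Proof.
elim: M => [|M IH]; first by rewrite inE -absz_eq0 leqn0.
by rewrite !inE IH; lia.
Qed.

Lemma zball_uniq M : uniq (zball M).
Proof.
elim: M => [|M IH] //=; rewrite !inE !mem_zball IH.
by apply/and3P; split => //; lia.
Qed.

Lemma sum_delta (V : pzRingType) (s : seq int) (p : int) (f : int -> V) :
  uniq s -> p \in s -> \sum_(m <- s) (m == p)%:R * f m = f p.
Proof.
move=> us ps; rewrite (bigD1_seq p)//= eqxx mul1r big1 ?addr0// => m mp.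
by rewrite (negbTE mp) mul0r.
Qed.

Variable a : R.
Local Notation D := `]a, (a + 1)[%classic.

Lemma cintegral_itv_indic f : cintegrable f ->
  cintegral (fun x => (\1_(`[a, (a + 1)[%classic) x)%:C * f x) =
  cintegral (fun x => (\1_D x)%:C * f x).
Proof.
move=> [f1 f2]; rewrite !cintegral_indic//.
by congr (_ +i* _); rewrite Rintegral_itv_obnd_cbnd//;
  apply: integrableS (measurableT) _ (@subsetT _ _) _.
Qed.

Lemma cintegral_tiling (M : nat) f : `|a| <= 1 -> cintegrable f ->
  (forall x, M%:R <= `|x| -> f x = 0) ->
  cintegral f = cintegral (fun x =>
    (\1_D x)%:C * \sum_(m <- zball M.+1) f (x + m%:~R)).
Proof.
move=> a1 fi f0.
have fsi (m : int) : cintegrable (fun x => f (x + m%:~R)).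
  exact: cintegrable_shift.
have indi (A : set R) g : measurable A -> cintegrable g ->
    cintegrable (fun x => (\1_A x)%:C * g x).
  move=> mA gi; under eq_fun do rewrite mulrC.
  apply: cintegrable_boundedM => //; first exact: cmeas_indic.
  by move=> x; rewrite sqn_indic indicE; case: (_ \in _).
(* Half-open cells, so that each [x] lies in exactly one of them, that of index [floor (x - a)]; for
   |x| < M and |a| <= 1 this index is at most M + 1 in absolute value. The missing endpoint of [D]
   is a null set. *)
transitivity (cintegral (fun x => \sum_(m <- zball M.+1)
    (\1_(`[a, (a + 1)[%classic) (x - m%:~R))%:C * f x)).
  congr cintegral; apply/funext => x; rewrite -mulr_suml.
  have [/f0 ->|xM] := leP M%:R `|x|; first by rewrite mulr0.
  rewrite [X in X * _](_ : _ = 1) ?mul1r//.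
  transitivity (\sum_(m <- zball M.+1) (m == Num.floor (x - a))%:R * (1 : R[i])).
    apply: eq_bigr => m _; rewrite mulr1 indicE.
    have -> : (x - m%:~R \in `[a, (a + 1)[%classic) = (m == Num.floor (x - a)).
      apply/idP/eqP; rewrite inE /= in_itv /=.
        by move=> /andP[h1 h2]; apply/esym/floor_def; rewrite intrD; lra.
      by move=> ->; have := floor_itv (x - a); rewrite intrD => /andP[h1 h2]; apply/andP; split; lra.
    by case: (m == _).
  rewrite sum_delta//; first exact: zball_uniq.
  rewrite mem_zball.
  have := floor_itv (x - a); set m := Num.floor _; rewrite intrD => /andP[h1 h2].
  move: xM a1; rewrite ltr_norml ler_norml => /andP[x1 x2] /andP[b1 b2].
  have h3 : m%:~R < (M.+2%:Z)%:~R :> R by rewrite -pmulrn -!natr1; lra.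
  have h4 : (- (M.+2%:Z))%:~R < m%:~R :> R by rewrite rmorphN /= -pmulrn -!natr1; lra.
  by rewrite !ltr_int in h3 h4; lia.
rewrite cintegral_sum; last first.
  move=> m.
  rewrite [X in cintegrable X](_ : _ = fun x =>
    (fun y => (\1_(`[a, (a + 1)[%classic) y)%:C * f (y + m%:~R)) (x - m%:~R)).
    apply: (@cintegrable_shift _ (- m%:~R)
      (fun y => (\1_(`[a, (a + 1)[%classic) y)%:C * f (y + m%:~R))).
    by apply: indi => //; exact: measurable_itv.
  by apply/funext => x; rewrite subrK.
transitivity (\sum_(m <- zball M.+1) cintegral (fun x => (\1_D x)%:C * f (x + m%:~R))).
  apply: eq_bigr => m _; rewrite -cintegral_itv_indic//.
  rewrite -(@cintegral_shift _ (- m%:~R) (fun x => (\1_(`[a, (a + 1)[%classic) x)%:C * f (x + m%:~R))).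
    by congr cintegral; apply/funext => x; rewrite subrK.
  by apply: cintegrable_meas; exact: indi.
rewrite -cintegral_sum; last by move=> m; exact: indi.
by congr cintegral; apply/funext => x; rewrite mulr_sumr.
Qed.

End FiniteTiling.

(** * Unitarity of the block diagonal matrices *)

Section Fiber.
Variable R : realType.
Implicit Types (a b x y : R[i]) (F : nat -> R -> R[i]).

(* Row [j] of the matrix [F j (xi + m)] is supported on the two columns [t j]
   and [q (t j)]; rows sharing their columns form a unitary block. *)
Definition fiber_blocks F (xi : R) := exists (t : nat -> nat) (q : nat -> int)
    (u v : nat -> R[i]),
  [/\ forall j m, F j (xi + m%:~R) =
        (m == t j)%:R * u j + (m == q (t j))%:R * v j,
      injective q,
      forall (s : nat) j, s = q (t j) :> int -> v j = 0,
      forall i j, t i = t j -> u i * (u j)^* + v i * (v j)^* = (i == j)%:R &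
      (forall j, (t j <= j /\ absz (q (t j)) <= j.+1)%N) /\
      forall (M : nat) (g : int -> R[i]), (forall m, (M < absz m)%N -> g m = 0) ->
        \sum_(j < M.*2.+2) sqn (g (t j) * (u j)^* + g (q (t j)) * (v j)^*) =
        \sum_(m <- zball M) sqn (g m)].

Lemma fiber_gram F xi i j M : fiber_blocks F xi -> (j < M)%N ->
  \sum_(m <- zball M) F i (xi + m%:~R) * (F j (xi + m%:~R))^* = (i == j)%:R.
Proof.
move=> [t [q [u [v [rowE qI v0 uni [bnd _]]]]]] jM.
have [tj qj] := bnd j.
have rowJ m : (F j (xi + m%:~R))^* =
    (m == t j)%:R * (u j)^* + (m == q (t j))%:R * (v j)^*.
  by rewrite rowE cJD !cJM; case: (m == _); case: (m == _); rewrite ?rmorph1 ?rmorph0.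
under eq_bigr do rewrite rowJ mulrDr 2!(mulrCA (F i _)).
rewrite big_split /= !sum_delta; [|exact: zball_uniq|by rewrite mem_zball; lia
  |exact: zball_uniq|by rewrite mem_zball; lia].
rewrite !rowE eqz_nat (inj_eq qI).
(* A first column of one row can coincide with a second column of another only where the second
   entry vanishes, so there are no mixed terms. *)
have E1 : (Posz (t j) == q (t i))%:R * v i = 0.
  by case: eqP => [/v0 ->|_]; rewrite ?mulr0 ?mul0r.
have E2 : (q (t j) == Posz (t i))%:R * u i * (v j)^* = 0.
  case: eqP => [/esym/v0 ->|_]; last by rewrite !mul0r.
  by rewrite rmorph0 mulr0.
rewrite E1 addr0 mulrDl E2 add0r.
have [/esym/uni|ntij] := eqVneq (t j) (t i); first by rewrite !mul1r.
rewrite !mul0r addr0; case: eqP => // ij; by rewrite ij eqxx in ntij.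
Qed.

(** The larger ball [zball N] contains both columns of each of the first 2M + 2 rows, some of which
    may lie outside [zball M]. *)
Lemma fiber_parseval F xi M N (g : R -> R[i]) : fiber_blocks F xi ->
  (forall m : int, (M < absz m)%N -> g (xi + m%:~R) = 0) -> (M.*2.+2 < N)%N ->
  \sum_(j < M.*2.+2) sqn (\sum_(m <- zball N) g (xi + m%:~R) * (F j (xi + m%:~R))^*) =
  \sum_(m <- zball M) sqn (g (xi + m%:~R)).
Proof.
move=> [t [q [u [v [rowE qI v0 uni [bnd H]]]]]] g0 MN.
rewrite -(H M (fun m => g (xi + m%:~R)))//; apply: eq_bigr => j _; congr sqn.
have [tj qj] := bnd j; have jM := ltn_ord j.
have rowJ m : (F j (xi + m%:~R))^* =
    (m == t j)%:R * (u j)^* + (m == q (t j))%:R * (v j)^*.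
  by rewrite rowE cJD !cJM; case: (m == _); case: (m == _); rewrite ?rmorph1 ?rmorph0.
under eq_bigr do rewrite rowJ mulrDr 2!(mulrCA (g _)).
by rewrite big_split /= !sum_delta//; try exact: zball_uniq; rewrite mem_zball; lia.
Qed.

(* The rows of the unitary matrix [[a, b], [conj b, - conj a]]. *)
Definition ublock a b (j : nat) : R[i] * R[i] :=
  if odd j then (b^*, - a^*) else (a, b).

Lemma ublock_sum a b x y : sqn a + sqn b = 1 ->
  sqn (x * a^* + y * b^*) + sqn (x * (b^*)^* + y * (- a^*)^*) = sqn x + sqn y.
Proof.
move=> ab; rewrite -[RHS]mulr1 -ab.
case: a b x y {ab} => [a1 a2] [b1 b2] [x1 x2] [y1 y2].
rewrite cJN !conjCK /sqn /=; ring.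
Qed.

Lemma ublock_unitary a b i j : sqn a + sqn b = 1 ->
  (ublock a b i).1 * (ublock a b j).1^* + (ublock a b i).2 * (ublock a b j).2^* =
  (odd i == odd j)%:R.
Proof.
move=> ab; rewrite /ublock; case: (odd i); case: (odd j) => /=;
  rewrite ?cJN ?conjCK ?mulrNN ?mulNr ?mulrN.
- by rewrite mulrC [_^* * a]mulrC !sqn_conjM addrC -rmorphD ab.
- by rewrite mulrC subrr.
- by rewrite mulrC subrr.
- by rewrite !sqn_conjM -rmorphD ab.
Qed.

End Fiber.

(** * From unitary fibers to an orthonormal and complete system of modulations *)

Section FiberBasis.
Variables (R : realType) (F : nat -> R -> R[i]).
Local Notation mu := (@lebesgue_measure R).
Local Notation a0 := (- (1 / 4) : R).
Local Notation D := `]a0, (a0 + 1)[%classic.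
Hypothesis mF : forall j, cmeas (F j).
Hypothesis F_le : forall j x, sqn (F j x) <= 4.
Hypothesis F_supp : forall j x, j.+1%:R <= `|x| -> F j x = 0.
Hypothesis F_fiber : forall x, D x -> fiber_blocks F x.

(** The Fourier transform of the translate by [kj.1], hence the minus sign in the frequency. *)
Definition modulated (kj : int * nat) (x : R) : R[i] :=
  trig 1 (- kj.1) x * F kj.2 x.

Lemma trig1_shift (k m : int) (x : R) : trig 1 k (x + m%:~R) = trig 1 k x.
Proof.
rewrite /trig !divr1 (_ : _ * (x + _) =
  2 * pi * k%:~R * x + 2 * pi * (k * m)%:~R); last by rewrite intrM; ring.
by rewrite expiD expi_2pi_int mulr1.
Qed.

Lemma L2_F j : L2 (F j).
Proof.
(* Halving [F j] brings its squared modulus from at most 4 to at most 1, as [L2_indic_le]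
   requires. *)
have -> : F j = fun x => 2 * ((\1_(window j) x)%:C * ((2%:R^-1)%:C * F j x)).
  apply/funext => x; rewrite indicE.
  have [xw|xw] := boolP (x \in window j).
    rewrite mul1r mulrA.
    have -> : 2 * (2%:R^-1 : R)%:C = 1 by rewrite -[2](rmorph_nat (real_complex R)) -rmorphM mulfV ?pnatr_eq0.
    by rewrite mul1r.
  rewrite mul0r mulr0 F_supp// leNgt; apply/negP => /windowP h.
  by move/negP: xw; apply; rewrite inE.
apply: L2Z; apply: (@L2_indic_le _ (- j.+1%:R) (2 * j.+1%:R)).
- by rewrite mulr_gt0.
- exact: measurable_itv.
- exact: subset_refl.
- exact: cmeasZ.
- move=> x; rewrite sqnM sqn_real; have := F_le j x.
  by rewrite exprVn -natrX; have := sqn_ge0 (F j x); lra.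
Qed.

Lemma L2_modulated kj : L2 (modulated kj).
Proof.
apply: L2_unimodularM; [exact: cmeas_trig|by move=> x; rewrite sqn_trig|].
exact: L2_F.
Qed.

Lemma a0_le1 : `|a0| <= 1.
Proof. by rewrite normrN ger0_norm; lra. Qed.

Lemma modulated_orthonormal p r :
  L2inner (modulated p) (modulated r) = (p == r)%:R.
Proof.
case: p r => [k i] [l j].
have H2 := cintegrable_mulJ (L2_modulated (k, i)) (L2_modulated (l, j)).
rewrite /L2inner (@cintegral_tiling _ a0 j.+1 _ a0_le1 H2); last first.
  by move=> x /F_supp; rewrite /modulated /= => ->; rewrite mulr0 rmorph0 mulr0.
(* The exponentials have period 1 and factor out of the periodized sum; what remains is the Gram sum
   of the fibers, constant in [x]. *)
transitivity (L2inner (itrig a0 1 (l - k)) (itrig a0 1 0) * (i == j)%:R).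
  rewrite /L2inner [RHS]mulrC -cintegralZ; last first.
    by apply: cintegrable_mulJ; apply: L2_itrig.
  congr cintegral; apply/funext => x; rewrite /itrig trig0 mulr1 conj_realC.
  rewrite indicE; have [xD|xD] := boolP (x \in D); last by rewrite !mul0r mulr0.
  rewrite !mul1r mulr1.
  rewrite (_ : \sum_(m <- zball j.+2) _ = trig 1 (l - k) x *
    \sum_(m <- zball j.+2) F i (x + m%:~R) * (F j (x + m%:~R))^*); last first.
    rewrite mulr_sumr; apply: eq_bigr => m _.
    rewrite /modulated /= !trig1_shift cJM -trigN opprK trigD mulrACA.
    by congr (_ * _); exact: mulrC.
  rewrite inE in xD.
  by rewrite (fiber_gram i (F_fiber xD) (leqnSn j.+1)) [LHS]mulrC.
rewrite itrig_orthogonal// mulr1 subr_eq0 -natrM mulnb; congr (_%:R).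
by rewrite [l == k]eq_sym.
Qed.

(* The coefficients of [G] against the modulations of [F j] are the Fourier
   coefficients on the unit interval of the periodization [P j] of
   [G * conj (F j)], and by unitarity of the fibers the squared norms of the
   [P j] add up to that of [G]. *)
Lemma modulated_parseval n (G : R -> R[i]) e : L2 G ->
  (forall x, n%:R <= `|x| -> G x = 0) -> 0 < e ->
  exists2 s : seq (int * nat), uniq s &
    nm G - e < \sum_(i <- s) sqn (L2inner G (modulated i)).
Proof.
(* On [D] |x| <= 1, so G(x + m) vanishes for |m| > M; the first [J] rows then carry all of [G], and
   [zball N] contains the columns of those rows. *)
move=> G2 G0 e0; pose M := n.+1; pose J := M.*2.+2; pose N := M.*2.+3.
pose P j x := (\1_D x)%:C * \sum_(m <- zball N) G (x + m%:~R) * (F j (x + m%:~R))^*.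
have P2 j : L2 (P j).
  have -> : P j = fun x => \sum_(m <- zball N)
     2 * ((\1_D x)%:C * (2%:R^-1)%:C * (F j (x + m%:~R))^* * G (x + m%:~R)).
    apply/funext => x; rewrite /P mulr_sumr; apply: eq_bigr => m _.
    have E : 2 * (2%:R^-1 : R)%:C = 1.
      by rewrite -[2](rmorph_nat (real_complex R)) -rmorphM mulfV ?pnatr_eq0.
    have gen (x1 x2 x3 x4 x5 : R[i]) :
      x1 * (x2 * x3 * x4 * x5) = x1 * x3 * (x2 * (x5 * x4)) by ring.
    by rewrite gen E [RHS]mul1r.
  apply: L2_sum => m; apply: L2Z; apply: (@L2_le _ _ (fun x => G (x + m%:~R))).
  - apply: cmeasM; last by apply: cmeas_shift; case: G2.
    apply: cmeasM; last by apply: cmeasJ; exact: cmeas_shift.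
    by apply: cmeasM; [exact: cmeas_indic|exact: cmeas_cst].
  - exact: L2_shift.
  - move=> x; rewrite sqnM ler_piMl ?sqn_ge0// !sqnM sqnJ sqn_indic sqn_real.
    have := F_le j (x + m%:~R); have := sqn_ge0 (F j (x + m%:~R)).
    rewrite exprVn -natrX indicE; case: (_ \in _) => /=; rewrite ?mul0r ?mul1r => *; lra.
have PD j x : ~ D x -> P j x = 0.
  by move=> xD; rewrite /P indicE memNset ?mul0r.
have coef k j : L2inner G (modulated (- k, j)) = L2inner (P j) (itrig a0 1 k).
  have H2 := cintegrable_mulJ G2 (L2_modulated (- k, j)).
  (* The bound on the support of [G] is deliberately weakened to 2M + 2, so that the tiling runs
     over [zball N] as in [P]. *)
  rewrite /L2inner (@cintegral_tiling _ a0 M.*2.+2 _ a0_le1 H2); last first.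
    move=> x xM; rewrite G0 ?mul0r//; apply: le_trans xM.
    by rewrite ler_nat /M; lia.
  congr cintegral; apply/funext => x; rewrite /P /itrig cJM conj_realC.
  rewrite indicE; have [xD|xD] := boolP (x \in D); last by rewrite !mul0r.
  rewrite !mul1r mulr_suml; apply: eq_bigr => m _.
  by rewrite /modulated /= opprK trig1_shift cJM [LHS]mulrCA [LHS]mulrC.
have nmGE : nm G = \sum_(j < J) nm (P j).
  apply: (@complexI R); rewrite rmorph_sum /= -L2inner_self.
  under eq_bigr do rewrite -L2inner_self.
  rewrite /L2inner -cintegral_sum; last by move=> j; exact: cintegrable_mulJ.
  have H2 := cintegrable_mulJ G2 G2.
  (* Here the sharp bound [n] is kept: the tiling runs over [zball M], the right-hand side of
     [fiber_parseval]. *)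
  rewrite (@cintegral_tiling _ a0 n _ a0_le1 H2); last first.
    by move=> x /G0 ->; rewrite mul0r.
  congr cintegral; apply/funext => x.
  have [xD|xD] := pselect (D x); last first.
    by rewrite indicE memNset// mul0r big1// => j _; rewrite PD// mul0r.
  rewrite indicE mem_set// mul1r.
  under eq_bigr do rewrite sqn_conjM.
  under [RHS]eq_bigr do rewrite sqn_conjM /P indicE mem_set//.
  rewrite -!rmorph_sum; congr (_%:C); apply/esym.
  under eq_bigr => j _ do rewrite [X in sqn X]mul1r.
  apply: (@fiber_parseval _ F x M N G (F_fiber xD)) => //.
  move=> m Mm; apply: G0.
  move: xD; rewrite /= in_itv /= => /andP[x1 x2].
  have : (M.+1%:R : R) <= `|m%:~R|.
    by rewrite -intr_norm pmulrn ler_int; lia.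
  have := ler_normB (x + m%:~R) x; rewrite [x + _ - x]addrC addKr.
  have : `|x| <= 1 by rewrite ler_norml; apply/andP; split; lra.
  by rewrite /M -!natr1; lra.
have J0 : (0 : R) < J%:R by [].
(* The tolerance [e] is shared equally among the [J] Fourier series. *)
have /choice[s_ Hs] : forall j, exists s : seq int, uniq s /\
    nm (P j) - e / J%:R < \sum_(k <- s) sqn (L2inner (P j) (itrig a0 1 k)).
  move=> j; have [|s us] := @parseval_itrig_fin _ a0 1 ltr01 (P j) (e / J%:R) (P2 j) (PD j).
    by rewrite divr_gt0.
  by rewrite mul1r => hs; exists s.
exists [seq (- k, j) | j <- index_iota 0 J, k <- s_ j].
  apply: allpairs_uniq_dep; first exact: iota_uniq.
    by move=> j _; case: (Hs j).
  by move=> [j k] [j' k'] _ _ /= [/oppr_inj -> ->].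
rewrite big_allpairs_dep big_mkord.
rewrite nmGE (_ : e = \sum_(j < J) e / J%:R); last first.
  by rewrite sumr_const card_ord -[RHS]mulr_natr divfK// gt_eqF.
rewrite -sumrB; apply: ltr_sum => [|j _].
  by apply/hasP; exists ord0; rewrite // mem_index_enum.
by under [ltRHS]eq_bigr do rewrite coef; have [] := Hs j.
Qed.

Lemma modulated_dense (G : R -> R[i]) e : L2 G -> 0 < e ->
  exists (s : seq (int * nat)) (c : int * nat -> R[i]),
    nm (fun x => G x - \sum_(i <- s) c i * modulated i x) < e.
Proof.
move=> G2 e0; have e4 : 0 < e / 4 by rewrite divr_gt0.
have /cvgrPdist_lt /(_ _ e4)[n _ /(_ n (leqnn n))] := nm_truncate_cvg G2.
rewrite sub0r normrN ger0_norm ?nm_ge0// nmBC => Hn.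
have t2 := L2_truncate n G2.
have [|s us Hs] := @modulated_parseval n.+1 _ _ t2 _ e4.
  move=> x xn; apply: truncate_eq0 => /windowP.
  by rewrite ltNge xn.
pose c i := L2inner (truncate n G) (modulated i).
exists s, c.
have lc2 : L2 (fun x => \sum_(i <- s) c i * modulated i x).
  by apply: L2_sum => i; apply: L2Z; exact: L2_modulated.
have E := @nm_sub_lincomb _ _ 1 modulated c s _ ltr01 us L2_modulated t2.
rewrite [X in _ = _ + X]big1 ?addr0 in E; last first.
- by move=> i _; rewrite mul1r subrr sqn0 mul0r.
have {E} := E _; rewrite -mulr_suml divr1 => /(_ _)/wrap[|E].
  by move=> i j; rewrite modulated_orthonormal mulr1.
have := nmD_le ltr01 (L2B G2 t2) (L2B t2 lc2).
rewrite invr1; under eq_fun do rewrite addrA subrK.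
move=> /le_lt_trans; apply; rewrite E; move: Hs Hn; rewrite -/(c _); lra.
Qed.

End FiberBasis.
(** * The Wilson system *)

Section Wilson.
Variables (R : realType) (phi : R -> R[i]).
Hypothesis cphi : continuous (re_fun phi) /\ continuous (im_fun phi).
Hypothesis phi_supp : forall x, 1 / 2 <= `|x| -> phi x = 0.
Hypothesis phi_sum : forall xi : R,
  (\esum_(k in [set: int]) ((sqn (phi (xi + k%:~R / 2)))%:E) = 1)%E.

Local Notation F := (wilson_hat phi).

Lemma sqn_phi_le1 x : sqn (phi x) <= 1.
Proof.
rewrite -lee_fin -(phi_sum x); apply: esum_ge; exists [set 0] => //.
by rewrite fsbig_set1 mul0r addr0.
Qed.

(** For such [y] every translate with [k] other than 0 and 1 is evaluated where |x| >= 1/2. *)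
Lemma sqn_phi_pair y : - (1 / 2) <= y <= 0 -> sqn (phi y) + sqn (phi (y + 1 / 2)) = 1.
Proof.
move=> /andP[y1 y2]; have := phi_sum y.
pose s := [set` [:: (0 : int); 1]].
rewrite (esumID s) ?setTI; last by move=> i _; rewrite lee_fin sqn_ge0.
rewrite [X in (_ + X)%E]esum1 ?adde0; last first.
  move=> k /= ks; rewrite phi_supp ?sqn0//.
  have : (k <= -1) || (2 <= k).
    by move: ks; rewrite /s /= !inE => /negP; lia.
  case/orP => h.
    have : k%:~R <= (-1)%:~R :> R by rewrite ler_int.
    rewrite mulrN1z => h'; rewrite ler0_norm; lra.
  have : 2%:~R <= k%:~R :> R by rewrite ler_int.
  move=> h'; rewrite ger0_norm; lra.
rewrite esum_fset; [|exact: finite_seq|by move=> i _; rewrite lee_fin sqn_ge0].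
rewrite /s -fsbig_seq// !big_cons big_nil mul0r !addr0 => /(congr1 fine) /=.
by rewrite addr0 mulr1z.
Qed.

Lemma sqn_phi0 : sqn (phi 0) = 1.
Proof.
have := @sqn_phi_pair 0; rewrite add0r (phi_supp (x := 1 / 2)) ?sqn0 ?addr0.
  by apply; lra.
by rewrite ger0_norm; lra.
Qed.

(** The closed bound on [y] is allowed because [phi] vanishes at 1/2 and -1/2 too, where a shift by
    1 leads from one endpoint to the other. *)
Lemma phi_int y (d : int) : `|y| <= 1 / 2 -> phi (y + d%:~R) = (d == 0)%:R * phi y.
Proof.
move=> y1; have [->|d0] := eqVneq d 0; first by rewrite addr0 mul1r.
rewrite mul0r phi_supp//.
have : (1 : R) <= `|d%:~R|.
  by rewrite -intr_norm -[1]/(1%:~R) ler_int; lia.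
have := ler_normB (y + d%:~R) y; rewrite [y + _ - y]addrC addKr; lra.
Qed.

Lemma conj_parE j z : conj_par j z = if odd j then z^* else z :> R[i].
Proof. by []. Qed.

Lemma wilson_hat_gt0 j x : (0 < j)%N -> F j x =
  conj_par j (phi (x - j%:R / 2 - 1 / 4)) +
  (-1) ^+ j * conj_par j (phi (x + j%:R / 2 + 1 / 4)).
Proof. by case: j. Qed.

Lemma conj_par_delta j (b : bool) z : conj_par j (b%:R * z) = b%:R * conj_par j z :> R[i].
Proof. by rewrite !conj_parE; case: (odd j) => //; case: b; rewrite ?mul1r// !mul0r rmorph0. Qed.

(** [p] and [q] are the columns whose shift brings the two arguments of [phi] back into [-1/2, 1/2].
    Conjugation and sign produce the second row of a unitary block. *)
Lemma wilson_row_odd n y z x (m p q : int) : `|y| <= 1 / 2 -> `|z| <= 1 / 2 ->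
  x - n.*2.+1%:R / 2 - 1 / 4 = y + (m - p)%:~R ->
  x + n.*2.+1%:R / 2 + 1 / 4 = z + (m - q)%:~R ->
  F n.*2.+1 x = (m == p)%:R * (phi y)^* + (m == q)%:R * (- (phi z)^*).
Proof.
move=> y1 z1 E1 E2; rewrite wilson_hat_gt0// E1 E2 !phi_int// !conj_par_delta.
by rewrite !conj_parE -signr_odd oddS odd_double /= expr1 mulN1r mulrN !subr_eq0.
Qed.

Lemma wilson_row_even n y z x (m p q : int) : (0 < n)%N ->
  `|y| <= 1 / 2 -> `|z| <= 1 / 2 ->
  x - n.*2%:R / 2 - 1 / 4 = y + (m - p)%:~R ->
  x + n.*2%:R / 2 + 1 / 4 = z + (m - q)%:~R ->
  F n.*2 x = (m == p)%:R * phi y + (m == q)%:R * phi z.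
Proof.
move=> n0 y1 z1 E1 E2; rewrite wilson_hat_gt0 ?double_gt0// E1 E2 !phi_int//.
rewrite !conj_par_delta.
by rewrite !conj_parE -signr_odd odd_double /= expr0 mul1r !subr_eq0.
Qed.

Lemma half_double n : (n.*2%:R / 2 : R) = n%:R.
Proof. by rewrite -muln2 natrM mulfK// pnatr_eq0. Qed.

Lemma half_doubleS n : (n.*2.+1%:R / 2 : R) = n%:R + 1 / 2.
Proof. by rewrite -natr1 mulrDl half_double. Qed.

Lemma wilson_row0_left xi (m : int) : - (1 / 4) < xi <= 1 / 4 ->
  F 0 (xi + m%:~R) = (m == 0)%:R * phi 0.
Proof.
move=> /andP[x1 x2]; rewrite /wilson_hat.
have [->|m0] := eqVneq m 0.
  rewrite addr0 (@mul1r R[i]); case: ltP => h; first by exfalso; lra.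
  by case: ltP => // h'; exfalso; lra.
rewrite (@mul0r R[i]); have : (1 <= m) || (m <= -1) by lia.
case/orP => h.
  have h' : (1 : R) <= m%:~R by rewrite -[1]/(1%:~R) ler_int.
  case: ltP => h2; last by exfalso; lra.
  by apply: phi_supp; rewrite ger0_norm; lra.
have h' : (m%:~R : R) <= -1 by rewrite -mulrN1z ler_int.
case: ltP => h2; first by exfalso; lra.
case: ltP => h3; last by exfalso; lra.
by apply: phi_supp; rewrite ler0_norm; lra.
Qed.

(** Off its plateau, row 0 has the entries of an even row with n = 0, so that it can be paired with
    row 1. *)
Lemma wilson_row0_right xi (m : int) : 1 / 4 < xi < 3 / 4 ->
  F 0 (xi + m%:~R) = (m == 0)%:R * phi (xi - 1 / 4) + (m == -1)%:R * phi (xi - 3 / 4).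
Proof.
move=> /andP[x1 x2]; rewrite /wilson_hat.
have : [|| m == 0, m == -1, 1 <= m | m <= -2] by lia.
case/or4P => [/eqP->|/eqP->|h|h].
- rewrite addr0 (@mul1r R[i]) (@mul0r R[i]) addr0; case: ltP => // h; exfalso; lra.
- rewrite (@mul0r R[i]) add0r (@mul1r R[i]) mulrN1z; case: ltP => h; first by exfalso; lra.
  case: ltP => h'; last by exfalso; lra.
  by congr phi; lra.
- have h' : (1 : R) <= m%:~R by rewrite -[1]/(1%:~R) ler_int.
  have [-> ->] : (m == 0) = false /\ (m == -1) = false by split; lia.
  rewrite !(@mul0r R[i]) addr0; case: ltP => h2; last by exfalso; lra.
  by apply: phi_supp; rewrite ger0_norm; lra.
- have h' : (m%:~R : R) <= -2 by rewrite -[-2]/((-2)%:~R) ler_int.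
  have [-> ->] : (m == 0) = false /\ (m == -1) = false by split; lia.
  rewrite !(@mul0r R[i]) addr0; case: ltP => h2; first by exfalso; lra.
  case: ltP => h3; last by exfalso; lra.
  by apply: phi_supp; rewrite ler0_norm; lra.
Qed.

Lemma double_ind (P : nat -> Prop) :
  (forall n, P n.*2) -> (forall n, P n.*2.+1) -> forall j, P j.
Proof.
move=> He Ho j; rewrite -(odd_double_half j).
by case: (odd j); [exact: Ho|exact: He].
Qed.

(** Rows 2n and 2n + 1 share the columns n and -(n + 1). *)
Lemma wilson_fiber_right xi : 1 / 4 < xi < 3 / 4 -> fiber_blocks F xi.
Proof.
move=> /[dup] xiI /andP[x1 x2].
pose b := phi (xi - 1 / 4); pose a := phi (xi - 3 / 4).
have ba : sqn b + sqn a = 1.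
  have H : - (1 / 2) <= xi - 3 / 4 <= 0 by lra.
  apply: etrans (sqn_phi_pair H); rewrite [RHS]addrC.
  by congr (sqn (phi _) + _); lra.
have n1 : `|xi - 1 / 4| <= 1 / 2 by rewrite ger0_norm; lra.
have n2 : `|xi - 3 / 4| <= 1 / 2 by rewrite ler0_norm; lra.
exists (fun j => j./2), (fun t => - t.+1%:Z), (fun j => (ublock b a j).1),
  (fun j => (ublock b a j).2); split.
- apply: double_ind => n m.
    rewrite doubleK /ublock odd_double /=.
    have [->|n0] := posnP n; first by rewrite wilson_row0_right.
    apply: wilson_row_even => //; rewrite half_double rmorphB /= ?rmorphN /= -!pmulrn -?[n.+1%:R]natr1; lra.
  rewrite /= uphalf_double /ublock /= odd_double /=.
  apply: wilson_row_odd => //; rewrite half_doubleS rmorphB /= ?rmorphN /= -!pmulrn -?[n.+1%:R]natr1; lra.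
- by move=> s t /oppr_inj [].
- by move=> s j; lia.
- move=> i j tij; rewrite ublock_unitary//; congr (nat_of_bool _)%:R.
  rewrite -[in RHS](odd_double_half i) -[in RHS](odd_double_half j) tij.
  by rewrite eqn_add2r; case: (odd i); case: (odd j).
- split.
    by move=> j; have := odd_double_half j; lia.
  move=> M g gM; pose X j := sqn (g (j./2)%:Z * (ublock b a j).1^* +
     g (- (j./2).+1%:Z) * (ublock b a j).2^*).
  have XE n : X n.*2 + X n.*2.+1 = sqn (g n) + sqn (g (- n.+1%:Z)).
    by rewrite /X /= uphalf_double doubleK /ublock /= odd_double /= ublock_sum.
  (* The columns 0, ..., K and -1, ..., -(K + 1) exceed [zball K] by one; for K = M the function [g]
     vanishes at the extra one. *)
  have H K : \sum_(j < K.*2.+2) X j = \sum_(m <- zball K) sqn (g m) + sqn (g (- K.+1%:Z)).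
    elim: K => [|K IH].
      by rewrite !big_ord_recr big_ord0 /= add0r (XE 0%N) big_cons big_nil addr0.
    rewrite doubleS 2!big_ord_recr /= IH.
    by rewrite -addrA -doubleS XE !big_cons; ring.
  rewrite -[LHS]/(\sum_(j < M.*2.+2) X j) H [X in _ + sqn X]gM ?sqn0 ?addr0//.
Qed.

(** Row 0 is alone in column 0, and for n > 0 the rows 2n - 1 and 2n share the columns n and -n. *)
Lemma wilson_fiber_left xi : - (1 / 4) < xi <= 1 / 4 -> fiber_blocks F xi.
Proof.
move=> /[dup] xiI /andP[x1 x2].
pose a := phi (xi - 1 / 4); pose b := phi (xi + 1 / 4).
have ab : sqn a + sqn b = 1.
  have H : - (1 / 2) <= xi - 1 / 4 <= 0 by lra.
  apply: etrans (sqn_phi_pair H).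
  by congr (_ + sqn (phi _)); lra.
have n1 : `|xi - 1 / 4| <= 1 / 2 by rewrite ler0_norm; lra.
have n2 : `|xi + 1 / 4| <= 1 / 2 by rewrite ger0_norm; lra.
(* For j = 0 the two columns coincide, so the second entry is set to 0. *)
exists uphalf, (fun t => - t%:Z),
  (fun j => if j is 0 then phi 0 else (ublock a b j).1),
  (fun j => if j is 0 then 0 else (ublock a b j).2); split.
- apply: double_ind => n m.
    rewrite uphalf_double; case: n => [|n].
      by rewrite -[0.*2]/0%N (wilson_row0_left m xiI) mulr0 addr0.
    rewrite (@wilson_row_even n.+1 (xi - 1 / 4) (xi + 1 / 4) _ m n.+1%:Z (- n.+1%:Z))//; last 2 first.
    + by rewrite half_double rmorphB /= -!pmulrn -?[n.+1%:R]natr1; lra.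
    + by rewrite half_double rmorphB /= ?rmorphN /= -!pmulrn -?[n.+1%:R]natr1; lra.
    by rewrite doubleS /ublock /= odd_double.
  rewrite /= doubleK /ublock /= odd_double /=.
  by apply: wilson_row_odd => //; rewrite half_doubleS rmorphB /= ?rmorphN /= -!pmulrn -?[n.+1%:R]natr1; lra.
- by move=> s t /oppr_inj [].
- by move=> s [|j]//=; lia.
- move=> [|i] [|j] tij.
  + by rewrite rmorph0 mulr0 addr0 sqn_conjM sqn_phi0.
  + by move: tij => /=; lia.
  + by move: tij => /=; lia.
  + rewrite ublock_unitary//; congr (nat_of_bool _)%:R.
    have := odd_double_half i; have := odd_double_half j; move: tij.
    by rewrite /= eqSS => -[] <-; case: (odd i); case: (odd j) => /=; lia.
- split.
    by move=> j; have := odd_double_half j; lia.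
  move=> M g gM; pose X j := sqn (g (uphalf j)%:Z * (if j is 0 then phi 0 else (ublock a b j).1)^* +
     g (- (uphalf j)%:Z) * (if j is 0 then 0 else (ublock a b j).2)^*).
  have XE n : X n.*2.+1 + X n.*2.+2 = sqn (g n.+1) + sqn (g (- n.+1%:Z)).
    by rewrite /X /= uphalf_double doubleK /ublock /= odd_double /= addrC ublock_sum.
  have H K : \sum_(j < K.*2.+1) X j = \sum_(m <- zball K) sqn (g m).
    elim: K => [|K IH].
      rewrite big_ord_recr big_ord0 /= add0r big_cons big_nil addr0 /X /=.
      have c0 : (0 : R[i])^* = 0 by exact: rmorph0.
      by rewrite c0 mulr0 addr0 sqnM sqnJ sqn_phi0 mulr1.
    rewrite doubleS 2!big_ord_recr /= IH.
    by rewrite -addrA XE !big_cons; ring.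
  (* The first 2M + 1 rows exhaust [zball M]; the remaining row sits in the columns M + 1 and -(M +
     1), where [g] vanishes. *)
  rewrite -[LHS]/(\sum_(j < M.*2.+2) X j) big_ord_recr /= H.
  rewrite /X /= doubleK (gM M.+1%:Z)// (gM (- M.+1%:Z)) ?abszN//.
  by rewrite !mul0r addr0 sqn0 addr0.
Qed.

Lemma wilson_fiber xi : `](- (1 / 4)), (- (1 / 4) + 1)[%classic xi ->
  fiber_blocks F xi.
Proof.
rewrite /= in_itv /= => /andP[x1 x2]; have [h|h] := leP xi (1 / 4).
  by apply: wilson_fiber_left; rewrite x1.
by apply: wilson_fiber_right; rewrite h; lra.
Qed.

Lemma cmeas_phi : cmeas phi.
Proof. by case: cphi => c1 c2; split; exact: continuous_measurable_fun. Qed.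

Lemma cmeas_wilson_hat j : cmeas (F j).
Proof.
have msh (c : R) : cmeas (fun x => phi (x + c)) by exact/cmeas_shift/cmeas_phi.
case: j => [|j].
  rewrite (_ : F 0 = fun x => (\1_(`](1 / 4), +oo[%classic) x)%:C * phi (x - 1 / 4) +
    ((\1_(`]-oo, (- (1 / 4))[%classic) x)%:C * phi (x + 1 / 4) +
    (\1_(`[(- (1 / 4)), (1 / 4)]%classic) x)%:C * phi 0)).
    apply: cmeasD; [|apply: cmeasD]; apply: cmeasM; try exact: msh;
      try exact: cmeas_cst; apply: cmeas_indic; exact: measurable_itv.
  apply/funext => x; rewrite /wilson_hat !indicE !mem_setE !in_itv /= andbT.
  case: ltP => h1; case: ltP => h2 /=.
  - by exfalso; lra.
  - by rewrite (@mul1r R[i]) !(@mul0r R[i]) !addr0.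
  - by rewrite (@mul1r R[i]) !(@mul0r R[i]) add0r addr0.
  - by rewrite !(@mul0r R[i]) !add0r (@mul1r R[i]).
have cmeas_conj_par (h : R -> R[i]) : cmeas h -> cmeas (fun x => conj_par j.+1 (h x)).
  move=> mh; under eq_fun do rewrite conj_parE.
  by case: (odd _) => //; exact: cmeasJ.
rewrite (_ : F j.+1 = fun x => conj_par j.+1 (phi (x + (- (j.+1%:R / 2) - 1 / 4))) +
  (-1) ^+ j.+1 * conj_par j.+1 (phi (x + (j.+1%:R / 2 + 1 / 4)))).
  by apply: cmeasD; [|apply: cmeasZ]; apply: cmeas_conj_par; exact: msh.
by apply/funext => x; rewrite wilson_hat_gt0// !addrA.
Qed.

Lemma wilson_hat_le j x : sqn (F j x) <= 4.
Proof.
case: j => [|j].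
  rewrite /wilson_hat; have h y : sqn (phi y) <= 4.
    by apply: le_trans (sqn_phi_le1 y) _; lra.
  by case: ifP => // _; case: ifP.
rewrite wilson_hat_gt0//; apply: le_trans (sqnD2_le _ _) _.
have sgn : sqn ((-1) ^+ j.+1 : R[i]) = 1.
  by rewrite -signr_odd; case: (odd _); rewrite ?expr1 ?expr0 ?sqnN -[1]/(1%:C) sqn_real expr1n.
have cp z : sqn (conj_par j.+1 z : R[i]) = sqn z.
  by rewrite conj_parE; case: (odd _) => //; rewrite sqnJ.
rewrite sqnM sgn !cp.
have := sqn_phi_le1 (x - j.+1%:R / 2 - 1 / 4).
have := sqn_phi_le1 (x + j.+1%:R / 2 + 1 / 4); lra.
Qed.

Lemma wilson_hat_supp j x : j.+1%:R <= `|x| -> F j x = 0.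
Proof.
case: j => [|j] jx.
  rewrite /wilson_hat; move: jx; rewrite ler_normr => /orP jx.
  case: ltP => h1.
    by apply: phi_supp; rewrite ger0_norm; lra.
  by case: ltP => h2; [apply: phi_supp; rewrite ler0_norm; lra|exfalso; lra].
rewrite wilson_hat_gt0//.
have j0 : (0 : R) <= j%:R by [].
have c0 : conj_par j.+1 0 = 0 :> R[i].
  by rewrite conj_parE; case: (odd _) => //; rewrite rmorph0.
move: jx; rewrite -[j.+2%:R]natr1 -[j.+1%:R]natr1 => jx.
have nx (y c : R) : `|x| <= `|x + c| + `|c|.
  by have := ler_normB (x + c) c; rewrite addrK.
rewrite -!addrA !phi_supp ?c0 ?mulr0 ?addr0//.
- have := nx 0 ((j%:R + 1) / 2 + 1 / 4); rewrite [`|_ / 2 + _|]ger0_norm; lra.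
- have := nx 0 (- ((j%:R + 1) / 2) - 1 / 4); rewrite -opprD normrN [`|_ / 2 + _|]ger0_norm; lra.
Qed.

End Wilson.

(** * Vanishing at the ends of the support, and conclusion *)

Section Support.
Variable R : realType.

(** The support condition says nothing at the endpoints themselves; there a point is approached from
    outside by x (1 + 1/(n + 1)). *)
Lemma continuous_eq0_extend (h : R -> R) (r : R) : 0 < r -> continuous h ->
  (forall x, r < `|x| -> h x = 0) -> forall x, r <= `|x| -> h x = 0.
Proof.
move=> r0 ch h0 x rx.
have x0 : 0 < `|x| by exact: lt_le_trans rx.
pose s (n : nat) := x * (1 + n.+1%:R^-1).
have s1 : s n @[n --> \oo] --> x.
  rewrite -[X in _ --> X]mulr1 -[in X in _ --> X](addr0 1).
  apply: cvgMr; apply: cvgD; first exact: cvg_cst.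
  exact: cvg_harmonic.
have s2 : h (s n) @[n --> \oo] --> h x by exact: continuous_cvg (ch x) s1.
have s3 : (fun n => h (s n)) = cst 0.
  apply/funext => n; apply: h0; rewrite /s normrM; apply: le_lt_trans rx _.
  rewrite ltr_pMr// ger0_norm; first by rewrite ltrDl.
  by rewrite addr_ge0.
by rewrite s3 in s2; exact: (cvg_unique _ s2 (cvg_cst _)).
Qed.

Lemma csupport_eq0 (phi : R -> R[i]) (r : R) : 0 < r ->
  continuous (re_fun phi) -> continuous (im_fun phi) ->
  csupport phi `<=` `[- r, r] -> forall x, r <= `|x| -> phi x = 0.
Proof.
move=> r0 c1 c2 sup.
have H x : r < `|x| -> phi x = 0.
  move=> rx; apply/eqP/negPn/negP => px.
  have : csupport phi x by exact: subset_closure.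
  by move/sup; rewrite /= in_itv /= -ler_norml leNgt rx.
move=> x rx; apply: complexP.
- by apply: (continuous_eq0_extend r0 c1 _ rx) => y /H; rewrite /re_fun => ->.
- by apply: (continuous_eq0_extend r0 c2 _ rx) => y /H; rewrite /im_fun => ->.
Qed.

Lemma csmooth_continuous (phi : R -> R[i]) : csmooth phi ->
  continuous (re_fun phi) /\ continuous (im_fun phi).
Proof.
move=> sm; split => x; have [d1 d2] := sm 0%N x.
- by apply: differentiable_continuous; apply/derivable1_diffP.
- by apply: differentiable_continuous; apply/derivable1_diffP.
Qed.

End Support.

(** Inner products and squared distances are preserved by [is_L2fourier]. A general [g] is first
    truncated, so that its transform is the integral one, and a combination close to that transform
    is carried back. *)
Lemma translates_basis (R : realType) (F f : nat -> R -> R[i]) :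
  (forall j, cmeas (F j)) ->
  (forall j x, sqn (F j x) <= 4) ->
  (forall j x, j.+1%:R <= `|x| -> F j x = 0) ->
  (forall x, `](- (1 / 4)), (- (1 / 4) + 1)[%classic x -> fiber_blocks F x) ->
  (forall j, is_L2fourier (f j) (F j)) ->
  is_L2_orthonormal_basis (fun kj : int * nat => translate kj.1 (f kj.2)).
Proof.
move=> mF F_le F_supp F_fib fF.
have eE kj : is_L2fourier (translate kj.1 (f kj.2)) (modulated F kj).
  have := is_L2fourier_translate kj.1 (fF kj.2).
  congr is_L2fourier; apply/funext => x; rewrite /modulated /trig divr1.
  by congr (expi _ * _); rewrite rmorphN /=; ring.
split.
- by move=> kj; apply/inLp2P; case: (is_L2fourier_L2 (eE kj)).
- move=> p r; rewrite (is_L2fourier_inner (eE p) (eE r)).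
  exact: modulated_orthonormal.
- move=> g /inLp2P g2 e e0.
  (* [L2dist] is the root of [nm], and two squared errors below [d] enter with factor 2, for a total
     below [e ^+ 2]. *)
  pose d := e ^+ 2 / 4; have d0 : 0 < d by rewrite divr_gt0// exprn_gt0.
  have /cvgrPdist_lt /(_ _ d0)[n _ /(_ n (leqnn n))] := nm_truncate_cvg g2.
  rewrite sub0r normrN ger0_norm ?nm_ge0// nmBC => Hn.
  have t2 := L2_truncate n g2; have ti := cintegrable_truncate n g2.
  have [s [c Hs]] := modulated_dense mF F_le F_supp F_fib (L2_fourier ti t2) d0.
  exists s, c.
  pose S x := \sum_(i <- s) c i * translate i.1 (f i.2) x.
  have sF : is_L2fourier S (fun x => \sum_(i <- s) c i * modulated F i x).
    by apply: is_L2fourier_sum => i; exact: is_L2fourierZ.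
  have S2 : L2 S by case: (is_L2fourier_L2 sF).
  have HtS : nm (fun x => truncate n g x - S x) < d.
    have := is_L2fourier_nm (is_L2fourierD (is_L2fourier_fourier ti t2) (is_L2fourierZ (-1) sF)).
    under eq_fun do rewrite mulN1r.
    by under [X in _ = nm X -> _]eq_fun do rewrite mulN1r; move=> ->.
  rewrite L2distE; last exact: L2B.
  rewrite lte_fin -[ltRHS](ger0_norm (ltW e0)) -sqrtr_sqr ltr_sqrt ?exprn_gt0//.
  have := nmD_le ltr01 (L2B g2 t2) (L2B t2 S2).
  rewrite invr1; under eq_fun do rewrite addrA subrK.
  move=> /le_lt_trans; apply; move: Hn HtS; rewrite /d; lra.
Qed.

Local Open Scope complex_scope.

(** The transform fixes the [f j] only almost everywhere: hence existence is stated separately, and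
    the basis property for every choice of representatives. *)
Theorem theorem2p4 (R : realType) (phi : R -> R[i]) (delta : R)
    (phi_smooth : csmooth phi)
    (delta_gt0 : 0 < delta) (delta_le : delta <= 1 / 4)
    (phi_supp : csupport phi `<=` `[- (1 / 4) - delta, 1 / 4 + delta])
    (phi_sum : forall xi : R,
      (\esum_(k in [set: int]) ((cabs (phi (xi + k%:~R / 2)) ^+ 2)%R)%:E)%E
      = 1%E)
    (phi_flat : forall m : nat, (1 <= m)%N -> cderive1n m phi 0 = 0) :
  (exists f : nat -> R -> R[i],
      forall j, is_L2fourier (f j) (wilson_hat phi j)) /\
  (forall f : nat -> R -> R[i],
      (forall j, is_L2fourier (f j) (wilson_hat phi j)) ->
      is_L2_orthonormal_basis
        (fun kj : int * nat => translate kj.1 (f kj.2))).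
Proof.
have cphi := csmooth_continuous phi_smooth.
have phi0 x : 1 / 2 <= `|x| -> phi x = 0.
  apply: csupport_eq0; [lra|exact: cphi.1|exact: cphi.2|].
  by move=> y /phi_supp; rewrite /= !in_itv /= => /andP[y1 y2]; apply/andP; split; lra.
have sum1 (xi : R) : (\esum_(k in [set: int]) (sqn (phi (xi + k%:~R / 2)))%:E = 1)%E.
  by rewrite -(phi_sum xi); apply: eq_esum => k _; rewrite sqr_cabs.
have mF := cmeas_wilson_hat cphi.
have F_le := wilson_hat_le sum1.
have F_supp := wilson_hat_supp phi0.
split; last first.
  move=> f; apply: translates_basis => //.
  exact: wilson_fiber.
(* Each [wilson_hat phi j] is in L2 with bounded support, hence a Fourier transform. *)
suff /choice[f Hf] : forall j, exists f, is_L2fourier f (wilson_hat phi j) by exists f.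
move=> j; apply: (@exists_L2fourier _ (- j.+1%:R) (2 * j.+1%:R)).
- by rewrite mulr_gt0.
- exact: L2_F.
- move=> x xj; apply: F_supp; rewrite leNgt; apply/negP => /windowP.
  exact: xj.
Qed.
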